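(* Let $n\ge 2$ and let $(M^n,g)$ be an $n$-dimensional non-flat complete Riemannian manifold with $n$-nonnegative curvature operator of the second kind. Then $M$ is locally irreducible.
   Context: Manifolds are connected. Non-flat means that the Riemann curvature tensor does not vanish identically. A complete Riemannian manifold is locally irreducible if its universal cover, with the lifted metric, is not isometric to a Riemannian product of two Riemannian manifolds of positive dimension. Curvature operator of the second kind: let $(V,g)$ be a Euclidean vector space of dimension $n\ge 2$ with orthonormal basis $\{e_1,\dots,e_n\}$, and let $R$ be an algebraic curvature operator on $V$, i.e. a 4-tensor $R_{ijkl}=R(e_i,e_j,e_k,e_l)$ with the symmetries of a Riemann curvature tensor, including the first Bianchi identity. The sign convention is that the sectional curvature of the plane spanned by $e_i,e_j$ ($i\neq j$) is $R_{ijij}$; the unit sphere has $R_{ijkl}=g_{ik}g_{jl}-g_{il}g_{jk}$. Let $S^2_0(V)$ be the space of traceless symmetric two-tensors on $V$, with inner product $\langle A,B\rangle=\mathrm{tr}(A^TB)$; its dimension is $N=\frac{(n-1)(n+2)}{2}$. The curvature operator of the second kind of $R$ is the symmetric bilinear form $\mathring{R}(\varphi,\psi)=\sum_{i,j,k,l=1}^n R_{ijkl}\varphi_{il}\psi_{jk}$ on $S^2_0(V)$. Its eigenvalues are those of the $N\times N$ matrix $(\mathring{R}(\varphi_a,\varphi_b))$ for any orthonormal basis $\{\varphi_a\}$ of $S^2_0(V)$. For an integer $1\le k\le N$, $R$ has $k$-nonnegative curvature operator of the second kind if the sum of the $k$ smallest eigenvalues (with multiplicity) of $\mathring{R}$ is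 nonnegative. A Riemannian manifold has this property if its Riemann curvature tensor $R_p$ on $V=T_pM$ has it for every point $p$. *)

(* Defs.v *)
From HB Require Import structures.
From mathcomp Require Import all_boot all_order all_algebra.
From mathcomp Require Import all_classical all_reals all_analysis.
Import Order.TTheory GRing.Theory Num.Theory.
Import numFieldNormedType.Exports.

Set Implicit Arguments.
Unset Strict Implicit.
Unset Printing Implicit Defensive.

Local Open Scope classical_set_scope.
Local Open Scope ring_scope.

(** ** Smooth functions on open subsets of R^n *)

Definition partial (R : realType) (n : nat) (i : 'I_n) (f : 'rV[R]_n -> R) :
    'rV[R]_n -> R :=
  fun x => 'D_(delta_mx ord0 i) f x.

(* Only meaningful for an open U: then the partial derivatives at the points of
   U do not depend on the values of f outside U. *)
Definition smooth_on (R : realType) (n : nat) (U : set 'rV[R]_n)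
    (f : 'rV[R]_n -> R) : Prop :=
  forall (s : seq 'I_n) (x : 'rV[R]_n), U x ->
    let Ds := foldr (@partial R n) f s in
    {for x, continuous Ds} /\
    forall i : 'I_n, derivable Ds x (delta_mx ord0 i).

(** ** Riemannian manifolds *)

(* [bwd] is the inverse of [fwd : dom -> img]; outside of [dom] and [img] the
   two functions take junk values. *)
Record chart (R : realType) (n : nat) (T : topologicalType) := Chart {
  dom : set T;
  img : set 'rV[R]_n;
  fwd : T -> 'rV[R]_n;
  bwd : 'rV[R]_n -> T }.

Record is_chart (R : realType) (n : nat) (T : topologicalType)
    (c : chart R n T) : Prop := IsChart {
  open_dom : open (dom c);
  open_img : open (img c);
  chart_fwdK : forall p, dom c p -> img c (fwd c p) /\ bwd c (fwd c p) = p;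
  chart_bwdK : forall x, img c x -> dom c (bwd c x) /\ fwd c (bwd c x) = x;
  fwd_continuous : forall p, dom c p -> {for p, continuous (fwd c)};
  bwd_continuous : forall x, img c x -> {for x, continuous (bwd c)} }.

(* The data of a Riemannian manifold; the axioms are in [riemannian_manifold].
   [metric M i x] is the Gram matrix of the metric with respect to the
   coordinate frame of the chart [atlas M i], at the point of coordinates x. *)
Record riemannian_data (R : realType) (n : nat) := RiemannianData {
  carrier :> topologicalType;
  chart_index : Type;
  atlas : chart_index -> chart R n carrier;
  metric : chart_index -> 'rV[R]_n -> 'M[R]_n }.

Arguments atlas {R n} M i : rename.
Arguments metric {R n} M i x : rename.

Definition local_rep (R : realType) (m n : nat) (M : riemannian_data R m)
    (N : riemannian_data R n) (F : M -> N) (i : chart_index M)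
    (j : chart_index N) : 'rV[R]_m -> 'rV[R]_n :=
  fun x => fwd (atlas N j) (F (bwd (atlas M i) x)).

Definition local_dom (R : realType) (m n : nat) (M : riemannian_data R m)
    (N : riemannian_data R n) (F : M -> N) (i : chart_index M)
    (j : chart_index N) : set 'rV[R]_m :=
  [set x | img (atlas M i) x /\ dom (atlas N j) (F (bwd (atlas M i) x))].

Definition smooth_map (R : realType) (m n : nat) (M : riemannian_data R m)
    (N : riemannian_data R n) (F : M -> N) : Prop :=
  continuous F /\
  forall (i : chart_index M) (j : chart_index N) (b : 'I_n),
    smooth_on (local_dom F i j) (fun x => local_rep F i j x ord0 b).

(* F^* g_N = g_M; the matrix ['J f x] acts on row vectors from the right, that
   is, its (a, b) entry is the a-th partial derivative of the b-th component. *)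
Definition preserves_metric (R : realType) (m n : nat)
    (M : riemannian_data R m) (N : riemannian_data R n) (F : M -> N) : Prop :=
  forall (i : chart_index M) (j : chart_index N) (x : 'rV[R]_m),
    local_dom F i j x ->
    let J := jacobian (local_rep F i j) x in
    metric M i x = J *m metric N j (local_rep F i j x) *m J^T.

(* For the identity map, [smooth_map] says that the transition maps are smooth
   and [preserves_metric] that the Gram matrices in the various charts define
   one tensor. *)
Record riemannian_manifold (R : realType) (n : nat)
    (M : riemannian_data R n) : Prop := RiemannianManifold {
  manifold_hausdorff : hausdorff_space M;
  manifold_second_countable : @second_countable M;
  manifold_connected : connected [set: M];
  manifold_chart : forall i : chart_index M, is_chart (atlas M i);
  manifold_cover : forall p : M, exists i : chart_index M, dom (atlas M i) p;
  manifold_smooth : smooth_map (M := M) (N := M) id;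
  metric_smooth : forall (i : chart_index M) (a b : 'I_n),
    smooth_on (img (atlas M i)) (fun x => metric M i x a b);
  metric_sym : forall (i : chart_index M) (x : 'rV[R]_n),
    img (atlas M i) x -> (metric M i x)^T = metric M i x;
  metric_posdef : forall (i : chart_index M) (x v : 'rV[R]_n),
    img (atlas M i) x -> v != 0 ->
    0 < (v *m metric M i x *m v^T) ord0 ord0;
  metric_tensor : preserves_metric (M := M) (N := M) id }.

Definition isometry (R : realType) (m n : nat) (M : riemannian_data R m)
    (N : riemannian_data R n) (F : M -> N) : Prop :=
  [/\ smooth_map F, preserves_metric F &
      exists G : N -> M, [/\ cancel F G, cancel G F & smooth_map G]].

Definition isometric (R : realType) (m n : nat) (M : riemannian_data R m)
    (N : riemannian_data R n) : Prop :=
  exists F : M -> N, isometry F.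

(** ** Riemannian products *)

Definition prod_chart (R : realType) (m n : nat) (S T : topologicalType)
    (c : chart R m S) (d : chart R n T) : chart R (m + n) (S * T)%type :=
  Chart (dom c `*` dom d)
    [set x | img c (lsubmx x) /\ img d (rsubmx x)]
    (fun p => row_mx (fwd c p.1) (fwd d p.2))
    (fun x => (bwd c (lsubmx x), bwd d (rsubmx x))).

Definition riemannian_product (R : realType) (m n : nat)
    (M : riemannian_data R m) (N : riemannian_data R n) :
    riemannian_data R (m + n) :=
  @RiemannianData R (m + n) (M * N)%type (chart_index M * chart_index N)%type
    (fun i => prod_chart (atlas M i.1) (atlas N i.2))
    (fun i x => block_mx (metric M i.1 (lsubmx x)) 0
                         0 (metric N i.2 (rsubmx x))).

(** ** Universal covers and local irreducibility *)

Definition simply_connected (R : realType) (T : topologicalType) : Prop :=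
  (forall p q : T, exists c : R -> T,
     [/\ {within `[0, 1], continuous c}, c 0 = p & c 1 = q]) /\
  forall c : R -> T, {within `[0, 1], continuous c} -> c 0 = c 1 ->
    exists H : R * R -> T,
      [/\ {within [set` `[0, 1]] `*` [set` `[0, 1]], continuous H},
          forall t : R, t \in `[0, 1] -> H (0, t) = c t /\ H (1, t) = c 0 &
          forall s : R, s \in `[0, 1] -> H (s, 0) = c 0 /\ H (s, 1) = c 0].

(* W is an open set that f maps homeomorphically onto U. *)
Definition sheet (S T : topologicalType) (f : S -> T) (U : set T)
    (W : set S) : Prop :=
  open W /\ exists h : T -> S,
    [/\ forall y, W y -> U (f y) /\ h (f y) = y,
        forall x, U x -> W (h x) /\ f (h x) = x &
        forall x, U x -> {for x, continuous h}].

Definition covering_map (S T : topologicalType) (f : S -> T) : Prop :=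
  [/\ continuous f,
      forall x : T, exists y : S, f y = x &
      forall x : T, exists U : set T, [/\ open U, U x &
        exists V : set (set S),
          [/\ forall W, V W -> sheet f U W, trivIset V id &
              f @^-1` U = \bigcup_(W in V) W]]].

(* Preservation of the metric says that Mt carries the lifted metric. *)
Definition riemannian_universal_cover (R : realType) (n : nat)
    (M Mt : riemannian_data R n) (f : Mt -> M) : Prop :=
  [/\ riemannian_manifold Mt, simply_connected R Mt, covering_map f,
      smooth_map f & preserves_metric f].

(* A universal cover is unique up to isometry, so that "the universal cover" may
   be read as "any universal cover". *)
Definition locally_irreducible (R : realType) (n : nat)
    (M : riemannian_data R n) : Prop :=
  forall (Mt : riemannian_data R n) (f : Mt -> M),
    riemannian_universal_cover f ->
    ~ exists (n1 n2 : nat) (M1 : riemannian_data R n1)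
        (M2 : riemannian_data R n2),
        [/\ (0 < n1)%N, (0 < n2)%N, riemannian_manifold M1,
            riemannian_manifold M2 & isometric Mt (riemannian_product M1 M2)].

(** ** Connection and curvature in coordinates *)

(* [christoffel g x k i j] is Gamma^k_{ij}. *)
Definition christoffel (R : realType) (n : nat) (g : 'rV[R]_n -> 'M[R]_n)
    (x : 'rV[R]_n) (k i j : 'I_n) : R :=
  2^-1 * \sum_(l < n) invmx (g x) k l *
    (partial i (fun y => g y j l) x + partial j (fun y => g y i l) x
     - partial l (fun y => g y i j) x).

(* The m-th coordinate of R(d_i, d_j) d_k, with the convention
   R(X, Y) Z = nabla_X nabla_Y Z - nabla_Y nabla_X Z - nabla_[X, Y] Z. *)
Definition curvature_endo (R : realType) (n : nat) (g : 'rV[R]_n -> 'M[R]_n)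
    (x : 'rV[R]_n) (m i j k : 'I_n) : R :=
  partial i (fun y => christoffel g y m j k) x
  - partial j (fun y => christoffel g y m i k) x
  + \sum_(l < n) (christoffel g x l j k * christoffel g x m i l
                  - christoffel g x l i k * christoffel g x m j l).

(* R_{ijkl} = g(R(d_i, d_j) d_l, d_k), so that R_{ijij} is the sectional
   curvature when d_i, d_j are orthonormal. *)
Definition riemann (R : realType) (n : nat) (g : 'rV[R]_n -> 'M[R]_n)
    (x : 'rV[R]_n) (i j k l : 'I_n) : R :=
  \sum_(m < n) g x k m * curvature_endo g x m i j l.

Definition nonflat (R : realType) (n : nat) (M : riemannian_data R n) : Prop :=
  exists (c : chart_index M) (x : 'rV[R]_n) (i j k l : 'I_n),
    img (atlas M c) x /\ riemann (metric M c) x i j k l != 0.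

Definition geodesic (R : realType) (n : nat) (M : riemannian_data R n)
    (c : R -> M) : Prop :=
  continuous c /\
  forall (i : chart_index M) (t : R), dom (atlas M i) (c t) ->
    let u : R -> 'rV[R]_n := fun s => fwd (atlas M i) (c s) in
    [/\ derivable u t 1, derivable (derive1 u) t 1 &
        forall k : 'I_n,
          derive1 (derive1 u) t ord0 k
          + \sum_(a < n) \sum_(b < n)
              christoffel (metric M i) (u t) k a b
              * derive1 u t ord0 a * derive1 u t ord0 b = 0].

(* Completeness in the geodesic sense: every initial point and velocity is the
   one of a geodesic defined on the whole real line. *)
Definition complete_manifold (R : realType) (n : nat)
    (M : riemannian_data R n) : Prop :=
  forall (i : chart_index M) (x v : 'rV[R]_n), img (atlas M i) x ->
    exists c : R -> M,
      [/\ geodesic c, c 0 = bwd (atlas M i) x &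
          derive1 (fun s => fwd (atlas M i) (c s)) 0 = v].

(** ** Curvature operator of the second kind *)

Definition curvature_second_kind (R : realType) (n : nat)
    (Rm : 'I_n -> 'I_n -> 'I_n -> 'I_n -> R) (phi psi : 'M[R]_n) : R :=
  \sum_(i < n) \sum_(j < n) \sum_(k < n) \sum_(l < n)
    Rm i j k l * phi i l * psi j k.

(* The dimension of the space of traceless symmetric n x n matrices. *)
Definition dimS20 (n : nat) : nat := (((n - 1) * (n + 2)) %/ 2)%N.

(* An orthonormal family of dimS20 n vectors is a basis. *)
Definition orthonormal_basis_S20 (R : realType) (n : nat)
    (phi : 'I_(dimS20 n) -> 'M[R]_n) : Prop :=
  (forall a, (phi a)^T = phi a /\ \tr (phi a) = 0) /\
  forall a b, \tr ((phi a)^T *m phi b) = (a == b)%:R.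

(* s lists the eigenvalues of A, with multiplicity, in nondecreasing order. *)
Definition eigenvalue_list (R : realType) (N : nat) (A : 'M[R]_N)
    (s : seq R) : Prop :=
  sorted <=%R s /\ char_poly A = \prod_(x <- s) ('X - x%:P).

Definition k_nonneg_second_kind (R : realType) (n k : nat)
    (Rm : 'I_n -> 'I_n -> 'I_n -> 'I_n -> R) : Prop :=
  forall phi : 'I_(dimS20 n) -> 'M[R]_n, orthonormal_basis_S20 phi ->
    exists s : seq R,
      eigenvalue_list (\matrix_(a, b) curvature_second_kind Rm (phi a) (phi b))
        s /\
      0 <= \sum_(x <- take k s) x.

(* Components of the tensor Rm in the frame given by the rows of E. *)
Definition tensor_in_frame (R : realType) (n : nat)
    (Rm : 'I_n -> 'I_n -> 'I_n -> 'I_n -> R) (E : 'M[R]_n)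
    (a b c d : 'I_n) : R :=
  \sum_(i < n) \sum_(j < n) \sum_(k < n) \sum_(l < n)
    E a i * E b j * E c k * E d l * Rm i j k l.

Definition manifold_k_nonneg_second_kind (R : realType) (n k : nat)
    (M : riemannian_data R n) : Prop :=
  forall (c : chart_index M) (x : 'rV[R]_n) (E : 'M[R]_n),
    img (atlas M c) x -> E *m metric M c x *m E^T = 1%:M ->
    k_nonneg_second_kind k (tensor_in_frame (riemann (metric M c) x) E).

(* Main.v *)
Require Import Defs.
From HB Require Import structures.
From mathcomp Require Import all_boot all_order all_algebra.
From mathcomp Require Import all_classical all_reals all_analysis.
From mathcomp Require Import ring lra.
Import Order.TTheory GRing.Theory Num.Theory.
Import numFieldNormedType.Exports.
Set Implicit Arguments.
Unset Strict Implicit.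
Unset Printing Implicit Defensive.
Local Open Scope classical_set_scope.
Local Open Scope ring_scope.

(** The theorem is a statement about single tangent spaces. Suppose that the universal cover is a
    Riemannian product. In an orthonormal frame adapted to the product, the curvature tensor of M
    at any point is then a sum of a tensor on V1 and a tensor on V2, of dimensions n1, n2 > 0,
    with all mixed components equal to zero. If its curvature operator of the second kind is
    n-nonnegative, where n = n1 + n2, then it vanishes; so M is flat.

    Algebra. The n1 n2 tensors e . f with e in V1 and f in V2 are in the kernel of the form, and
    n1 n2 >= n - 1. Together with n - 1 zeros, a negative eigenvalue would make the sum of the n
    smallest eigenvalues negative; therefore the form is positive semidefinite
    ([second_kind_psd]). Its value on e_i . e_j is twice a sectional curvature, which is thus
    nonnegative. Its value on the traceless tensor n2 g1 - n1 g2 is a negative combination of the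
    scalar curvatures of the factors. So all sectional curvatures of coordinate planes vanish
    ([sectional_eq0]). But then the tensors e_i . e_j and e_i^2 - e_j^2, which span the whole
    space, are isotropic for a positive semidefinite form and are in its kernel. This makes the
    curvature tensor skew in the two middle indices, and the Bianchi identity makes it zero
    ([split_psd_curv_eq0]).

    Geometry. The covering map Mt -> M and the isometry of Mt with the product are local
    isometries, and the curvature tensor is natural under these ([riemann_pullback]). In
    coordinates, the Christoffel symbols are the matrices of a connection that is determined by
    two properties, the compatibility with the metric and the symmetry of the symbols
    ([conn_mx_unique]). Pullbacks have the two properties, which gives the transformation law of
    the connection and, after differentiation, the one of the curvature. So does the
    connection of a product that is assembled from those of the factors, and this shows that
    the curvature of a product is split ([riemann_block_split]).

    Analysis. Smoothness is expressed by iterated partial derivatives. The chain rule and the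
    symmetry of second derivatives rest on [differentiable_of_continuous_partials] and
    [derive_schwarz]. *)

(** * Positive semidefinite forms *)

(** The Cauchy-Schwarz argument in one variable: near t = 0 a nonzero linear term would
    dominate the quadratic one and make the expression negative for one sign of t. *)
Lemma quadratic_ge0_linear_coef0 (R : realFieldType) (p q : R) :
  (forall t, 0 <= t * p *+ 2 + t ^+ 2 * q) -> p = 0.
Proof.
move=> h; have q0 : 0 <= q.
  have := h 1; have := h (-1); rewrite !mulr2n; lra.
(* q + 1 in place of the minimizer - p / q, since q may be 0. *)
have := h (- p / (q + 1)).
have q1 : q + 1 != 0 by rewrite gt_eqF //; lra.
have -> : (- p / (q + 1)) * p *+ 2 + (- p / (q + 1)) ^+ 2 * q
   = - (p ^+ 2 * ((q + 2) / (q + 1) ^+ 2)) by field.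
rewrite oppr_ge0 pmulr_lle0; last by rewrite divr_gt0 ?exprn_gt0 //; lra.
move=> p2; apply/eqP; rewrite -sqrf_eq0 eq_le p2 sqr_ge0 //.
Qed.

Definition dotp (R : realType) (n : nat) (u v : 'rV[R]_n) : R :=
  (u *m v^T) ord0 ord0.

Section DotProduct.
Variables (R : realType) (n : nat).
Implicit Types (u v w : 'rV[R]_n) (a : R).

Lemma dotpE u v : dotp u v = \sum_i u 0 i * v 0 i.
Proof. by rewrite /dotp mxE; apply: eq_bigr => i _; rewrite mxE. Qed.

Lemma dotpC u v : dotp u v = dotp v u.
Proof. by rewrite !dotpE; apply: eq_bigr => i _; rewrite mulrC. Qed.

Lemma dotpDl u v w : dotp (u + v) w = dotp u w + dotp v w.
Proof. by rewrite /dotp mulmxDl mxE. Qed.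

Lemma dotpZl a u v : dotp (a *: u) v = a * dotp u v.
Proof. by rewrite /dotp -scalemxAl mxE. Qed.

Lemma dotpDr u v w : dotp u (v + w) = dotp u v + dotp u w.
Proof. by rewrite dotpC dotpDl !(dotpC u). Qed.

Lemma dotpZr a u v : dotp u (a *: v) = a * dotp u v.
Proof. by rewrite dotpC dotpZl dotpC. Qed.

Lemma dotp_ge0 u : 0 <= dotp u u.
Proof. by rewrite dotpE; apply: sumr_ge0 => i _; rewrite -expr2 sqr_ge0. Qed.

Lemma dotp_eq0 u : (dotp u u == 0) = (u == 0).
Proof.
apply/eqP/eqP => [|->]; last by rewrite dotpE big1 // => i _; rewrite mxE mul0r.
rewrite dotpE => /psumr_eq0P u0; apply/rowP => i.
have /eqP := u0 (fun i _ => sqr_ge0 (u 0 i)) i isT.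
by rewrite -expr2 sqrf_eq0 mxE => /eqP.
Qed.

Lemma dotp_gt0 u : u != 0 -> 0 < dotp u u.
Proof. by move=> u0; rewrite lt_def dotp_eq0 u0 dotp_ge0. Qed.

Lemma continuous_quadform (B : 'M[R]_n) :
  continuous (fun v : 'rV[R]_n => dotp (v *m B) v).
Proof.
have -> : (fun v : 'rV[R]_n => dotp (v *m B) v) =
   (fun v => \sum_j \sum_i (v 0 i * B i j * v 0 j)).
  apply/funext => v; rewrite dotpE; apply: eq_bigr => j _.
  by rewrite mxE mulr_suml.
apply: continuous_big => [|j _]; first exact: add_continuous.
apply: continuous_big => [|i _ v]; first exact: add_continuous.
apply: (@continuousM R _ (fun v : 'rV[R]_n => v 0 i * B i j)); last exact: coord_continuous.
by apply: (@continuousM R _ (fun v : 'rV[R]_n => v 0 i));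
  [exact: coord_continuous|exact: cst_continuous].
Qed.

End DotProduct.

Section SymmetricMatrices.
Variables (R : realType) (N : nat).
Implicit Types (A : 'M[R]_N) (u v : 'rV[R]_N).

Lemma dot_symmx A u v : A^T = A -> dotp (u *m A) v = dotp (v *m A) u.
Proof. by move=> sA; rewrite (dotpC _ u) /dotp trmx_mul sA mulmxA. Qed.

(** The quadratic form has a minimum, namely 0, at the isotropic vector v, so its
    differential at v vanishes. *)
Lemma psd_isotropic_ker A v : A^T = A ->
  (forall u, 0 <= dotp (u *m A) u) -> dotp (v *m A) v = 0 -> v *m A = 0.
Proof.
move=> sA psd v0; apply/rowP => j; rewrite [RHS]mxE.
set d : 'rV[R]_N := delta_mx 0 j.
have -> : (v *m A) 0 j = dotp (v *m A) d.
  by rewrite /dotp trmx_delta -colE [RHS]mxE.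
apply: (@quadratic_ge0_linear_coef0 _ _ (dotp (d *m A) d)) => t.
have := psd (v + t *: d).
rewrite mulmxDl -scalemxAl !(dotpDl, dotpDr, dotpZl, dotpZr) v0.
rewrite (dot_symmx d v sA) mulr2n; lra.
Qed.

(** The quadratic form attains its minimum l on the unit sphere, and a minimizer c is
    isotropic for the positive semidefinite matrix A - l. By [psd_isotropic_ker] it is an
    eigenvector, so that l is a root of the characteristic polynomial. *)
Lemma symmx_psd_of_roots A : A^T = A ->
  (forall x, root (char_poly A) x -> 0 <= x) -> forall v, 0 <= dotp (v *m A) v.
Proof.
move=> sA Aroots v.
have [->|v0] := eqVneq v 0.
  by rewrite dotpE big1 // => i _; rewrite mul0mx mxE mul0r.
(* The unit sphere; the identity matrix makes it a level set of a quadratic form. *)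
pose S := [set u : 'rV[R]_N | dotp (u *m 1%:M) u = 1].
have Snz u : u != 0 -> S ((Num.sqrt (dotp u u))^-1 *: u).
  move=> u0; have up := dotp_gt0 u0.
  rewrite /S /= mulmx1 dotpZl dotpZr mulrA -expr2 exprVn (sqr_sqrtr (ltW up)).
  by rewrite mulVf // gt_eqF.
have Sc : compact S.
  apply: bounded_closed_compact.
    exists 1; split; first exact: num_real.
    move=> x x1 u; rewrite /S /= mulmx1 dotpE => u1.
    rewrite /Num.Def.normr /= mx_normrE; apply: bigmax_le; first by apply: ltW; lra.
    move=> [i j] _ /=; rewrite ord1 ltW // (le_lt_trans _ x1) //.
    rewrite -(@expr_le1 _ 2) // real_normK ?num_real // -u1 (bigD1 j) //= -expr2.
    by rewrite lerDl sumr_ge0 // => k _; rewrite -expr2 sqr_ge0.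
  have -> : S = (fun u => dotp (u *m 1%:M) u) @^-1` [set 1] by [].
  apply: preimage_closed; last exact: closed_eq.
  by move=> u _; exact: continuous_quadform.
have [] := @EVT_min_rV R _ (fun v => dotp (v *m A) v) S _ Sc _.
- by exists ((Num.sqrt (dotp v v))^-1 *: v); exact: Snz.
- by apply: continuous_subspaceT; exact: continuous_quadform.
move=> c; rewrite inE => Scc cmin.
set l := dotp (c *m A) c in cmin.
(* By homogeneity: c is an isotropic vector of the psd form of A - l. *)
have lmin u : l * dotp u u <= dotp (u *m A) u.
  have [->|u0] := eqVneq u 0; first by rewrite !mul0mx /dotp mul0mx mxE mulr0.
  have := cmin _ (mem_set (Snz u u0)); have up := dotp_gt0 u0.
  rewrite -scalemxAl dotpZl dotpZr mulrA -expr2 exprVn (sqr_sqrtr (ltW up)).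
  by rewrite ler_pdivlMl // mulrC.
have l0 : 0 <= l; last first.
  by apply: le_trans (lmin v); rewrite mulr_ge0 ?dotp_ge0.
apply: Aroots; rewrite -eigenvalue_root_char.
have c0 : c != 0.
  apply/eqP => c0; move: Scc; rewrite /S /= c0 mul0mx /dotp mul0mx mxE => /eqP.
  by rewrite eq_sym oner_eq0.
apply/eigenvalueP; exists c => //.
move: Scc; rewrite /S /= mulmx1 => cc.
have dB u : dotp (u *m (A - l%:M)) u = dotp (u *m A) u - l * dotp u u.
  by rewrite mulmxBr mul_mx_scalar -scaleNr dotpDl dotpZl mulNr.
have := @psd_isotropic_ker (A - l%:M) c.
rewrite mulmxBr mul_mx_scalar => H; apply/eqP; rewrite -subr_eq0; apply/eqP.
apply: H => [|u|]; first by rewrite linearB /= sA tr_scalar_mx.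
  by rewrite dB subr_ge0.
by rewrite -mul_mx_scalar -mulmxBr dB cc mulr1 subrr.
Qed.

End SymmetricMatrices.

(** * Eigenvalues of a symmetric matrix with many zero rows *)

Lemma char_poly_zero_rows (R : realType) (N : nat) (A : 'M[R]_N)
    (Z : {set 'I_N}) :
  (forall a b, a \in Z -> A a b = 0) -> 'X^#|Z| %| char_poly A.
Proof.
move=> A0.
(* A zero row of A gives a row of 'X - A with 'X on the diagonal as its only entry. *)
pose B := \matrix_(i, j) (if i \in Z then (i == j)%:R else char_poly_mx A i j).
pose d : 'rV[{poly R}]_N := \row_i (if i \in Z then 'X else 1).
have dB : char_poly_mx A = diag_mx d *m B.
  apply/matrixP => i j; rewrite mul_diag_mx !mxE; case: ifP => iZ.
    by rewrite A0 // subr0 mulr_natr.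
  by rewrite mul1r.
rewrite /char_poly dB det_mulmx det_diag.
have -> : \prod_i d 0 i = 'X^#|Z|.
  rewrite (eq_bigr (fun i => if i \in Z then 'X else 1)); last first.
    by move=> i _; rewrite mxE.
  by rewrite -big_mkcond /= prodr_const.
exact: dvdp_mulr.
Qed.

Lemma count_mem0_ge (R : realType) (z : nat) (s : seq R) :
  'X^z %| \prod_(x <- s) ('X - x%:P) -> (z <= count_mem 0%R s)%N.
Proof.
rewrite -(mu_prod_XsubC 0) mup_geq ?subr0 // monic_neq0 //.
exact: monic_prod_XsubC.
Qed.

(** In a nondecreasing list the nonpositive elements come first. *)
Lemma take_le0 (R : realType) (n : nat) (s : seq R) :
  sorted <=%R s -> (n <= count (fun x : R => x <= 0)%R s)%N ->
  all (fun x => x <= 0) (take n s).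
Proof.
elim: s n => [|x s IH] [|n] //= ss; have ssx := path_sorted ss.
case: ltP => x0; last by rewrite add1n ltnS; exact: IH.
rewrite add0n (eq_in_count (a2 := pred0)) ?count_pred0 // => y ys.
have /allP /(_ y ys) xy := order_path_min le_trans ss.
by apply/negbTE; rewrite -ltNge (lt_le_trans x0).
Qed.

(** One negative element and n - 1 zeros are n nonpositive elements; so the n smallest
    elements are all nonpositive, and the first of them is negative. *)
Lemma sum_take_lt0 (R : realType) (n : nat) (s : seq R) :
  (0 < n)%N -> sorted <=%R s -> (n <= (count_mem 0%R s).+1)%N ->
  has (fun x => x < 0) s -> \sum_(x <- take n s) x < 0.
Proof.
move=> n0 ss c0 hneg.
have cle : (n <= count (fun x : R => x <= 0)%R s)%N.
  apply: leq_trans c0 _; rewrite -addn1.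
  have h1 : (1 <= count (fun x : R => x < 0)%R s)%N by rewrite -has_count.
  apply: leq_trans (leq_add (leqnn _) h1) _.
  rewrite -count_predUI [X in (_ + X)%N](_ : _ = 0%N) ?addn0.
    by apply: sub_count => x /= /orP[/eqP->|/ltW].
  rewrite (eq_count (a2 := pred0)) ?count_pred0 // => x /=.
  by case: eqP => // ->; rewrite ltxx.
have := take_le0 ss cle.
case: s n n0 ss {c0 cle} hneg => // x s [//|n] _ ss hneg /=.
move=> /andP[_ /allP tle]; rewrite big_cons -[ltRHS]addr0 ltr_leD //.
  case/hasP: hneg => y; rewrite inE => /predU1P[->//|ys].
  have /allP /(_ y ys) xy := order_path_min le_trans ss.
  exact: le_lt_trans.
by rewrite big_seq; apply: sumr_le0.
Qed.

(** Each zero row contributes a zero eigenvalue. With n - 1 of them, a negative eigenvalue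
    would make the sum of the n smallest eigenvalues negative. *)
Lemma psd_of_take_sum_ge0 (R : realType) (N n : nat) (A : 'M[R]_N)
    (Z : {set 'I_N}) (s : seq R) :
  A^T = A -> (forall a b, a \in Z -> A a b = 0) -> (0 < n <= #|Z|.+1)%N ->
  eigenvalue_list A s -> 0 <= \sum_(x <- take n s) x ->
  forall v, 0 <= dotp (v *m A) v.
Proof.
move=> sA Z0 /andP[n0 nZ] [ss cA] sum0; apply: symmx_psd_of_roots => // x.
rewrite cA root_prod_XsubC => xs; rewrite leNgt; apply/negP => x0.
move: sum0; rewrite leNgt => /negP[]; apply: sum_take_lt0 => //.
  rewrite (leq_trans nZ) // ltnS count_mem0_ge // -cA.
  exact: char_poly_zero_rows.
by apply/hasP; exists x.
Qed.

(** * An orthonormal basis of the traceless symmetric matrices *)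

Lemma exists_orthogonal_with_row (R : realType) (n : nat) (u : 'rV[R]_n) (i : 'I_n) :
  dotp u u = 1 -> exists H : 'M[R]_n, H *m H^T = 1%:M /\ row i H = u.
Proof.
move=> u1; have [ue|ue] := eqVneq u (delta_mx 0 i).
  by exists 1%:M; rewrite trmx1 mulmx1 row1 ue.
(* The Householder reflection that exchanges u and the i-th basis vector. *)
pose w := delta_mx 0 i - u.
have w0 : dotp w w != 0 by rewrite dotp_eq0 subr_eq0 eq_sym.
have ww : dotp w w = 2 * w 0 i.
  have ed (v : 'rV[R]_n) : dotp (delta_mx 0 i) v = v 0 i.
    by rewrite /dotp -rowE !mxE.
  have uw : dotp u w = u 0 i - 1 by rewrite dotpC dotpDl ed -scaleN1r dotpZl u1 mulN1r.
  rewrite {1}/w dotpDl ed -scaleN1r dotpZl uw /w !mxE !eqxx /=; ring.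
have wE : w = delta_mx 0 i - u by [].
clearbody w; pose c := 2 / dotp w w.
exists (1%:M - c *: (w^T *m w)); split.
  have -> : (1%:M - c *: (w^T *m w))^T = 1%:M - c *: (w^T *m w).
    by apply/matrixP => j k; rewrite !mxE eq_sym !big_ord1 !mxE [w 0 k * _]mulrC.
  rewrite mulmxBl mul1mx mulmxBr mulmx1 -scalemxAl -scalemxAr.
  have -> : w^T *m w *m (w^T *m w) = dotp w w *: (w^T *m w).
    rewrite -mulmxA (mulmxA w) [w *m w^T]mx11_scalar -[(w *m w^T) 0 0]/(dotp w w).
    by rewrite mul_scalar_mx scalemxAr.
  have -> : c *: (c *: (dotp w w *: (w^T *m w))) = 2 *: (c *: (w^T *m w)).
    by rewrite !scalerA; congr (_ *: _); rewrite /c; field.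
  by rewrite scaler_nat mulr2n opprB addrK subrK.
apply/rowP => j; rewrite !mxE big_ord1 !mxE.
have -> : c * (w 0 i * w 0 j) = w 0 j.
  have wi : w 0 i != 0 by apply: contraNneq w0 => w0; rewrite ww w0 mulr0.
  by rewrite /c ww; field.
by rewrite wE !mxE eqxx /= opprB eq_sym addrC subrK.
Qed.

Section TracelessSymmetricBasis.
Variables (R : realType) (n : nat).
Implicit Types (A B : 'M[R]_n).

Lemma trace_trmxM A B : \tr (A^T *m B) = \sum_i \sum_j A i j * B i j.
Proof.
rewrite /mxtrace exchange_big; apply: eq_bigr => i _; rewrite mxE.
by apply: eq_bigr => j _; rewrite mxE.
Qed.

Definition traceless_symmetric A := A^T = A /\ \tr A = 0.

Definition sym_delta (i j : 'I_n) : 'M[R]_n := delta_mx i j + delta_mx j i.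

Lemma trace_delta_mx (i j : 'I_n) : \tr (delta_mx i j : 'M[R]_n) = (i == j)%:R.
Proof.
rewrite /mxtrace (bigD1 i) //= mxE eqxx /= big1 ?addr0 // => k ki.
by rewrite mxE (negbTE ki).
Qed.

Lemma sym_deltaP i j : i != j -> traceless_symmetric (sym_delta i j).
Proof.
move=> ij; split; first by rewrite linearD /= !trmx_delta addrC.
by rewrite linearD /= !trace_delta_mx (negbTE ij) eq_sym (negbTE ij) addr0.
Qed.

Lemma trace_deltaM i j B : \tr ((delta_mx i j)^T *m B) = B i j.
Proof.
rewrite trace_trmxM (bigD1 i) //= (bigD1 j) //= mxE !eqxx mul1r.
rewrite !big1 ?addr0 // => [k ki|k ki].
  by rewrite big1 // => l _; rewrite mxE (negbTE ki) mul0r.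
by rewrite mxE (negbTE ki) andbF mul0r.
Qed.

Lemma trace_sym_deltaM i j B : \tr ((sym_delta i j)^T *m B) = B i j + B j i.
Proof. by rewrite linearD /= mulmxDl linearD /= !trace_deltaM. Qed.

Lemma trace_diagM (u : 'rV[R]_n) B :
  \tr ((diag_mx u)^T *m B) = \sum_i u 0 i * B i i.
Proof.
rewrite trace_trmxM; apply: eq_bigr => i _; rewrite (bigD1 i) //= mxE eqxx.
by rewrite big1 ?addr0 // => j ji; rewrite mxE eq_sym (negbTE ji) mul0r.
Qed.

Variable i0 : 'I_n.

(** An off-diagonal basis element for each pair i < j, and a diagonal one for each row of an
    orthogonal matrix other than the distinguished row i0. *)
Definition S20_index : finType :=
  ({p : 'I_n * 'I_n | (p.1 < p.2)%N} + {k : 'I_n | k != i0})%type.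

Lemma card_S20_index : #|S20_index| = dimS20 n.
Proof.
rewrite card_sum !card_sig.
have -> : #|[pred k : 'I_n | k != i0]| = n.-1.
  by rewrite cardC1 card_ord.
have -> : #|[pred p : 'I_n * 'I_n | (p.1 < p.2)%N]| = 'C(n, 2).
  rewrite -sum1_card -bin2_sum big_mkord.
  rewrite -(pair_big_dep xpredT (fun i j : 'I_n => (i < j)%N) (fun _ _ => 1%N)) /=.
  rewrite (exchange_big_dep xpredT) //=; apply: eq_bigr => j _.
  rewrite sum1_card -[RHS]card_ord -(card_codom (f := widen_ord (ltnW (ltn_ord j)))).
    apply: eq_card => i; rewrite [LHS]unfold_in /=; apply/idP/codomP => [ij|[k ->]].
      by exists (Ordinal ij); apply: val_inj.
    exact: (ltn_ord k).
  by move=> x y /(congr1 val) /= xy; apply: val_inj.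
rewrite bin2 /dimS20; case: n i0 => [[]//|m] _ /=.
rewrite subn1 /= divn2 addn2 (_ : (m * m.+3 = m.+1 * m + m.*2)%N); last first.
  by rewrite -mul2n -mulnDl addn2 mulnC.
by rewrite halfD odd_double andbF add0n doubleK.
Qed.

Variable H : 'M[R]_n.
Hypothesis Horth : H *m H^T = 1%:M.
Hypothesis Hrow : forall j j', H i0 j = H i0 j'.

(** When row i0 of the orthogonal matrix H is constant, the other rows are an orthonormal
    basis of the vectors with coordinate sum 0, that is, of the traceless diagonal matrices. *)
Definition S20_elt (k : S20_index) : 'M[R]_n :=
  match k with
  | inl p => (Num.sqrt 2)^-1 *: sym_delta (val p).1 (val p).2
  | inr k => diag_mx (row (val k) H)
  end.

Lemma dotp_rowH i j : \sum_k H i k * H j k = (i == j)%:R.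
Proof.
have := congr1 (fun M : 'M[R]_n => M i j) Horth; rewrite !mxE => <-.
by apply: eq_bigr => k _; rewrite mxE.
Qed.

Lemma Hconst_neq0 : H i0 i0 != 0.
Proof.
apply/eqP => h0; have := dotp_rowH i0 i0; rewrite eqxx big1.
  by move=> /eqP; rewrite eq_sym oner_eq0.
by move=> k _; rewrite (Hrow k i0) h0 mul0r.
Qed.

Lemma S20_elt_traceless k : traceless_symmetric (S20_elt k).
Proof.
case: k => [p|k] /=.
  have /sym_deltaP[h1 h2] : (val p).1 != (val p).2.
    by apply/eqP => e; have := valP p; rewrite /= e ltnn.
  by split; rewrite linearZ /= ?h1 ?h2 ?mulr0.
split; first by rewrite tr_diag_mx.
(* The trace is the inner product with the constant row, up to a nonzero factor. *)
rewrite mxtrace_diag; apply: (mulIf Hconst_neq0); rewrite mul0r mulr_suml.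
rewrite -[RHS](_ : (val k == i0)%:R = 0); last by rewrite (negbTE (valP k)).
rewrite -dotp_rowH; apply: eq_bigr => j _; by rewrite mxE (Hrow i0 j).
Qed.

Lemma S20_elt_orthonormal k l : \tr ((S20_elt k)^T *m S20_elt l) = (k == l)%:R.
Proof.
have s2 : (Num.sqrt 2)^-1 * ((Num.sqrt 2)^-1 * 2) = 1 :> R.
  rewrite mulrA -expr2 exprVn sqr_sqrtr ?mulVf //.
case: k => [p|k] /=.
  rewrite linearZ /= -scalemxAl linearZ /= trace_sym_deltaM.
  case: l => [q|l] /=.
    rewrite (inj_eq inl_inj) -val_eqE /sym_delta !mxE.
    case: p q => [[p1 p2] lp] [[q1 q2] lq] /=.
    rewrite [RHS](_ : _ = ((p1 == q1) && (p2 == q2))%:R) // !(andbC (p2 == _)).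
    move: lp lq => /= lp lq.
    have -> : (p1 == q2) && (p2 == q1) = false.
      apply/negP => /andP[/eqP e1 /eqP e2]; move: lp lq; rewrite e1 e2 => lp.
      by rewrite ltnNge (ltnW lp).
    case: (_ && _); rewrite /= ?(addr0, add0r, mulr0) //.
    by rewrite -mulrDr -natrD.
  have np : (val p).1 != (val p).2.
    by apply/eqP => e; have := valP p; rewrite /= e ltnn.
  by rewrite !mxE (negbTE np) (eq_sym (val p).2) (negbTE np) addr0 mulr0.
rewrite trace_diagM; case: l => [p|l] /=.
  rewrite big1 // => i _; rewrite /sym_delta !mxE.
  have np : (val p).1 != (val p).2.
    by apply/eqP => e; have := valP p; rewrite /= e ltnn.
  case: (eqVneq i (val p).1) => [->|_]; last by rewrite /= andbF addr0 !mulr0.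
  by rewrite (negbTE np) /= addr0 !mulr0.
rewrite (inj_eq inr_inj) -val_eqE -dotp_rowH.
by apply: eq_bigr => j _; rewrite !mxE eqxx.
Qed.

End TracelessSymmetricBasis.

Section Spanning.
Variables (R : realType) (n : nat) (i0 : 'I_n) (H : 'M[R]_n).
Hypothesis Horth : H *m H^T = 1%:M.
Hypothesis Hrow : forall j j', H i0 j = H i0 j'.
Implicit Types (B : 'M[R]_n).

Definition S20_span B := exists c : S20_index i0 -> R,
  B = \sum_k c k *: S20_elt H k.

Lemma S20_spanD B B' : S20_span B -> S20_span B' -> S20_span (B + B').
Proof.
move=> [c ->] [c' ->]; exists (fun k => c k + c' k).
by rewrite -big_split; apply: eq_bigr => k _; rewrite scalerDl.
Qed.

Lemma S20_spanZ a B : S20_span B -> S20_span (a *: B).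
Proof.
move=> [c ->]; exists (fun k => a * c k).
by rewrite scaler_sumr; apply: eq_bigr => k _; rewrite scalerA.
Qed.

Lemma S20_span0 : S20_span 0.
Proof. by exists (fun _ => 0); rewrite big1 // => k _; rewrite scale0r. Qed.

Lemma S20_span_sum (I : Type) (r : seq I) (P : pred I) (F : I -> 'M[R]_n) :
  (forall i, P i -> S20_span (F i)) -> S20_span (\sum_(i <- r | P i) F i).
Proof. exact: (big_ind S20_span S20_span0 S20_spanD). Qed.

Lemma S20_span_elt k : S20_span (S20_elt (i0 := i0) H k).
Proof.
exists (fun l => (k == l)%:R); rewrite (bigD1 k) //= eqxx scale1r big1 ?addr0 //.
by move=> l lk; rewrite eq_sym (negbTE lk) scale0r.
Qed.

Lemma S20_span_sym_delta i j : i != j -> S20_span (sym_delta R i j).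
Proof.
wlog ij : i j / (i < j)%N => [h ij|_].
  have [|ji|e] := ltngtP i j; first by move=> /h; apply.
    by rewrite /sym_delta addrC; apply: h; rewrite // eq_sym.
  by move: ij; rewrite (val_inj e) eqxx.
pose k : S20_index i0 := inl (exist (fun p : 'I_n * 'I_n => (p.1 < p.2)%N) (i, j) ij).
have -> : sym_delta R i j = Num.sqrt 2 *: S20_elt (i0 := i0) H k.
  by rewrite /= scalerA mulfV ?scale1r // gt_eqF // sqrtr_gt0.
exact/S20_spanZ/S20_span_elt.
Qed.

Lemma S20_span_diag (d : 'rV[R]_n) : \sum_i d 0 i = 0 -> S20_span (diag_mx d).
Proof.
move=> d0.
(* Expansion of d in the rows of H: the constant row i0 gets the coefficient 0. *)
have -> : diag_mx d = \sum_k dotp d (row k H) *: diag_mx (row k H).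
  transitivity (diag_mx (\sum_k dotp d (row k H) *: row k H)); last first.
    by rewrite linear_sum; apply: eq_bigr => k _; rewrite linearZ.
  congr diag_mx; rewrite -[LHS]mulmx1 -(mulmx1C Horth) mulmxA mulmx_sum_row.
  apply: eq_bigr => k _; congr (_ *: _); rewrite dotpE mxE.
  by apply: eq_bigr => j _; rewrite !mxE.
apply: S20_span_sum => k _; have [->|ki] := eqVneq k i0.
  rewrite dotpE (eq_bigr (fun j => d 0 j * H i0 i0)); last first.
    by move=> j _; rewrite mxE (Hrow j i0).
  by rewrite -mulr_suml d0 mul0r scale0r; exact: S20_span0.
apply: S20_spanZ.
exact: (S20_span_elt (inr (exist (fun k : 'I_n => k != i0) k ki))).
Qed.

(** A symmetric B is its diagonal part plus half the sum of B i j (e_ij + e_ji) over all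
    ordered pairs i != j. *)
Lemma S20_span_all B : traceless_symmetric B -> S20_span B.
Proof.
move=> [sB tB]; pose d : 'rV[R]_n := \row_i B i i.
have -> : B = diag_mx d +
    \sum_i \sum_(j | i != j) (B i j / 2) *: sym_delta R i j.
  apply/matrixP => a b; rewrite mxE summxE.
  have inner i : (\sum_(j | i != j) (B i j / 2) *: sym_delta R i j) a b =
     \sum_(j | i != j) (B i j / 2) * (((a == i) && (b == j))%:R +
       ((a == j) && (b == i))%:R).
    by rewrite summxE; apply: eq_bigr => j _; rewrite !mxE.
  rewrite (eq_bigr _ (fun i _ => inner i)) !mxE; have [->|ab] := eqVneq a b.
    rewrite mulr1n big1 ?addr0 // => i _; rewrite big1 // => j ij.
    case: (eqVneq b i) => [bi|_]; case: (eqVneq b j) => [bj|_];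
      rewrite ?addr0 ?mulr0 //=.
    by move: ij; rewrite -bi bj eqxx.
  rewrite mulr0n add0r (bigD1 a) //= (bigD1 b) //= !eqxx /= (negbTE ab) /= addr0 mulr1.
  rewrite big1 ?addr0; last first.
    move=> j /andP[aj jb]; rewrite eq_sym (negbTE jb) (negbTE aj) /= addr0 mulr0 //.
  rewrite (bigD1 b) 1?eq_sym //= (bigD1 a) 1?eq_sym //= !eqxx (negbTE ab) /= add0r mulr1.
  rewrite big1 ?addr0; last first.
    move=> j /andP[bj ja]; rewrite (eq_sym a j) (negbTE ja) /= addr0 mulr0 //.
  rewrite big1 ?addr0; last first.
    move=> i /andP[ia ib]; rewrite big1 // => j ij.
    by rewrite (eq_sym a i) (negbTE ia) (eq_sym b i) (negbTE ib) andbF addr0 mulr0.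
  have -> : B b a = B a b by rewrite -[in LHS]sB mxE.
  by field.
apply: S20_spanD; first by apply: S20_span_diag; rewrite -[RHS]tB; apply: eq_bigr => i _;
  rewrite mxE.
by apply: S20_span_sum => i _; apply: S20_span_sum => j ij;
  exact/S20_spanZ/S20_span_sym_delta.
Qed.

End Spanning.

(** * The curvature operator of the second kind *)

Section SecondKind.
Variables (R : realType) (n : nat) (T : 'I_n -> 'I_n -> 'I_n -> 'I_n -> R).
Implicit Types (B C : 'M[R]_n).
Local Notation csk := (curvature_second_kind T).

Lemma second_kindDl B B' C : csk (B + B') C = csk B C + csk B' C.
Proof.
rewrite /curvature_second_kind.
do 4![rewrite -big_split; apply: eq_bigr => ? _].
by rewrite !mxE /=; ring.
Qed.

Lemma second_kindZl a B C : csk (a *: B) C = a * csk B C.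
Proof.
rewrite /curvature_second_kind.
do 4![rewrite mulr_sumr; apply: eq_bigr => ? _].
by rewrite !mxE /=; ring.
Qed.

Lemma second_kindDr B C C' : csk B (C + C') = csk B C + csk B C'.
Proof.
rewrite /curvature_second_kind.
do 4![rewrite -big_split; apply: eq_bigr => ? _].
by rewrite !mxE /=; ring.
Qed.

Lemma second_kindZr a B C : csk B (a *: C) = a * csk B C.
Proof.
rewrite /curvature_second_kind.
do 4![rewrite mulr_sumr; apply: eq_bigr => ? _].
by rewrite !mxE /=; ring.
Qed.

Lemma second_kind_suml (I : finType) (F : I -> 'M[R]_n) C :
  csk (\sum_i F i) C = \sum_i csk (F i) C.
Proof.
apply: (big_morph (fun B => csk B C)) => [B B'|]; first exact: second_kindDl.
by rewrite -(scale0r (0 : 'M[R]_n)) second_kindZl mul0r.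
Qed.

Hypothesis anti12 : forall i j k l, T j i k l = - T i j k l.
Hypothesis anti34 : forall i j k l, T i j l k = - T i j k l.

Lemma second_kindC B C : csk B C = csk C B.
Proof.
rewrite /curvature_second_kind exchange_big; apply: eq_bigr => i _ /=.
apply: eq_bigr => j _; rewrite exchange_big; apply: eq_bigr => k _ /=.
apply: eq_bigr => l _; rewrite anti12 anti34 opprK; ring.
Qed.

Lemma second_kind_delta p q r s : csk (delta_mx p q) (delta_mx r s) = T p r s q.
Proof.
rewrite /curvature_second_kind (bigD1 p) //= (bigD1 r) //= (bigD1 s) //= (bigD1 q) //=.
rewrite !mxE !eqxx !mulr1 !big1 ?addr0 //.
- move=> i ip; rewrite big1 // => j _; rewrite big1 // => k _; rewrite big1 // => l _.
  by rewrite mxE (negbTE ip) mulr0 mul0r.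
- move=> j jr; rewrite big1 // => k _; rewrite big1 // => l _.
  by rewrite !mxE (negbTE jr) mulr0.
- move=> k ks; rewrite big1 // => l _.
  by rewrite !mxE (negbTE ks) andbF mulr0.
- by move=> l lq; rewrite !mxE (negbTE lq) andbF mulr0 mul0r.
Qed.

End SecondKind.

(** The index k keeps its place in the Bianchi identity because [riemann] puts the vector on
    which R(d_i, d_j) acts in the last place: R_{ijkl} = g(R(d_i, d_j) d_l, d_k). *)
Record algebraic_curvature (R : realType) (n : nat)
    (T : 'I_n -> 'I_n -> 'I_n -> 'I_n -> R) : Prop := AlgebraicCurvature {
  curv_anti12 : forall i j k l, T j i k l = - T i j k l;
  curv_anti34 : forall i j k l, T i j l k = - T i j k l;
  curv_bianchi : forall i j k l, T i j k l + T j l k i + T l i k j = 0 }.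

Definition in_first (n1 n2 : nat) (i : 'I_(n1 + n2)) : bool := (i < n1)%N.

Lemma in_first_lshift n1 n2 (i : 'I_n1) : in_first (lshift n2 i).
Proof. exact: (ltn_ord i). Qed.

Lemma in_first_rshift n1 n2 (i : 'I_n2) : in_first (rshift n1 i) = false.
Proof. by rewrite /in_first /= ltnNge leq_addr. Qed.

(** The shape of the curvature tensor of a Riemannian product, in a frame adapted to the
    product: only components within one factor may be nonzero. *)
Definition split_tensor (R : realType) (n1 n2 : nat)
    (T : 'I_(n1 + n2) -> 'I_(n1 + n2) -> 'I_(n1 + n2) -> 'I_(n1 + n2) -> R) :=
  forall i j k l, ~~ [&& in_first j == in_first i, in_first k == in_first i
                       & in_first l == in_first i] -> T i j k l = 0.

Lemma exists_const_row_orthogonal (R : realType) (n : nat) (i0 : 'I_n) :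
  exists H : 'M[R]_n, H *m H^T = 1%:M /\ forall j j', H i0 j = H i0 j'.
Proof.
pose u : 'rV[R]_n := const_mx (Num.sqrt n%:R)^-1.
have n0 : 0 < n%:R :> R by rewrite ltr0n (leq_ltn_trans (leq0n i0)).
have [|H [HH Hu]] := @exists_orthogonal_with_row R n u i0.
  rewrite dotpE (eq_bigr (fun=> n%:R^-1)) => [|i _].
    by rewrite sumr_const card_ord -[_ *+ n]mulr_natr mulVf // gt_eqF.
  by rewrite !mxE -expr2 exprVn sqr_sqrtr // ltW.
exists H; split=> // j j'; have := congr1 (fun M : 'rV[R]_n => (M 0 j, M 0 j')) Hu.
by rewrite !mxE => -[-> ->].
Qed.

(** The n1 n2 mixed directions are at least n - 1 in number, where n = n1 + n2; this is
    where the n of n-nonnegativity meets the dimension of the manifold. *)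
Lemma leq_addn_mulnS (a b : nat) :
  (0 < a)%N -> (0 < b)%N -> (a + b <= (a * b).+1)%N.
Proof.
by case: a b => // a [//|b] _ _; rewrite mulSn addnC -addnS leq_add2l ltnS leq_pmulr.
Qed.

(** A tensor e_i . f_j with e_i and f_j in different factors is in the kernel of the form,
    because each term of the form involves a mixed component of T. The zero rows which
    these tensors give allow the application of [psd_of_take_sum_ge0]. *)
Lemma second_kind_psd (R : realType) (n1 n2 : nat)
    (T : 'I_(n1 + n2) -> 'I_(n1 + n2) -> 'I_(n1 + n2) -> 'I_(n1 + n2) -> R) :
  (0 < n1)%N -> (0 < n2)%N -> algebraic_curvature T -> split_tensor T ->
  k_nonneg_second_kind (n1 + n2) T ->
  forall B, traceless_symmetric B -> 0 <= curvature_second_kind T B B.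
Proof.
move=> n10 n20 [a12 a34 _] Tsplit Tk B BS.
pose n := (n1 + n2)%N.
pose i0 : 'I_n := lshift n2 (Ordinal n10).
have [H [HH Hrow]] := exists_const_row_orthogonal R i0.
have cardK := card_S20_index i0.
pose kof (a : 'I_(dimS20 n)) : S20_index i0 := enum_val (cast_ord (esym cardK) a).
pose aof (k : S20_index i0) : 'I_(dimS20 n) := cast_ord cardK (enum_rank k).
have kofK : cancel kof aof.
  by move=> a; rewrite /aof /kof enum_valK cast_ordKV.
have aofK : cancel aof kof.
  by move=> k; rewrite /aof /kof cast_ordK enum_rankK.
pose phi a := S20_elt H (kof a).
have phiON : orthonormal_basis_S20 phi.
  split=> [a|a b]; first exact: S20_elt_traceless.
  by rewrite S20_elt_orthonormal // (can_eq kofK).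
(* A basis that contains the mixed tensors makes their rows of A vanish. *)
have [s [sA sum0]] := Tk _ phiON.
set A := (X in eigenvalue_list X s) in sA.
(* The indices of the first factor precede those of the second one. *)
pose mixed (p : 'I_n1 * 'I_n2) : S20_index i0 :=
  inl (exist (fun p : 'I_n * 'I_n => (p.1 < p.2)%N) (lshift n2 p.1, rshift n1 p.2)
     (leq_trans (ltn_ord p.1) (leq_addr _ _))).
pose Z := [set aof (mixed p) | p : 'I_n1 * 'I_n2].
have cZ : #|Z| = (n1 * n2)%N.
  rewrite card_imset ?card_prod ?card_ord // => p q /(can_inj aofK) [] e1 e2.
  move: p q e1 e2 => [p1 p2] [q1 q2] /= e1 e2.
  by congr pair; apply: val_inj; [|exact: addnI e2].
have psd : forall v, 0 <= dotp (v *m A) v.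
  apply: (@psd_of_take_sum_ge0 R _ (n1 + n2) A Z s) => //.
  - by apply/matrixP => a b; rewrite !mxE second_kindC.
  - move=> a b /imsetP[p _ ->];
    rewrite mxE /phi aofK /= second_kindZl /curvature_second_kind.
    rewrite big1 ?mulr0 // => i _; rewrite big1 // => j _.
    rewrite big1 // => k _; rewrite big1 // => l _.
    have [il|il] := eqVneq (in_first l) (in_first i); last first.
      by rewrite Tsplit ?mul0r // (negbTE il) !andbF.
    rewrite /sym_delta !mxE.
    rewrite [X in nat_of_bool X](_ : _ = false) ?add0r; last first.
      apply/negP => /andP[/eqP ei /eqP el].
      by move: il; rewrite ei el in_first_lshift in_first_rshift.
    rewrite (_ : _ && _ = false) ?mulr0 ?mul0r //.
    apply/negP => /andP[/eqP ei /eqP el].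
    by move: il; rewrite ei el in_first_lshift in_first_rshift.
  - by rewrite addn_gt0 n10 /= cZ leq_addn_mulnS.
have [c ->] := S20_span_all HH Hrow BS.
pose v : 'rV[R]_(dimS20 n) := \row_a c (kof a).
suff -> : curvature_second_kind T (\sum_k c k *: S20_elt H k)
    (\sum_k c k *: S20_elt H k) = dotp (v *m A) v by [].
have reidx : \sum_k c k *: S20_elt H k = \sum_a v 0 a *: phi a.
  rewrite (reindex kof) /=; last by exists aof => k _; [exact: kofK|exact: aofK].
  by apply: eq_bigr => a _; rewrite mxE.
rewrite reidx second_kind_suml dotpE.
rewrite [RHS](eq_bigr (fun b => \sum_a v 0 a * A a b * v 0 b)) => [|b _]; last first.
  by rewrite [(v *m A) _ _]mxE mulr_suml.
rewrite [RHS]exchange_big; apply: eq_bigr => a _;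
  rewrite second_kindZl second_kindC // second_kind_suml mulr_sumr.
by apply: eq_bigr => b _; rewrite second_kindZl second_kindC // [A _ _]mxE; ring.
Qed.

Section AlgebraicCurvature.
Variables (R : realType) (n : nat) (T : 'I_n -> 'I_n -> 'I_n -> 'I_n -> R).
Hypothesis TC : algebraic_curvature T.
Let a12 := curv_anti12 TC.
Let a34 := curv_anti34 TC.

(** The octahedron argument: a linear combination of the four Bianchi identities in which
    the four indices take turns in the fixed place. *)
Lemma curv_pair_sym i j k l : T i j k l = T k l i j.
Proof.
have b1 := curv_bianchi TC i j k l; have b2 := curv_bianchi TC i j l k.
have b3 := curv_bianchi TC k l i j; have b4 := curv_bianchi TC k l j i.
have := a34 i j k l; have := a34 l i k j; have := a34 j k l i.
have := a34 k l i j.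
have : T l j i k = T j l k i by rewrite a12 a34 opprK.
have : T i k j l = T k i l j by rewrite a12 a34 opprK.
lra.
Qed.

Lemma curv_diag12 i k l : T i i k l = 0.
Proof. have := a12 i i k l; lra. Qed.

Lemma curv_diag34 i j k : T i j k k = 0.
Proof. have := a34 i j k k; lra. Qed.

(** Skew symmetry under three adjacent transpositions makes T totally skew, so that the three
    terms of the Bianchi identity are equal. *)
Lemma curv_eq0_of_anti23 :
  (forall i j k l, T i j k l = - T i k j l) -> forall i j k l, T i j k l = 0.
Proof.
move=> a23.
have rot i j k l : T j l k i = T i j k l.
  by rewrite a23 a12 a34 opprK a23 a12 opprK a23 opprK.
move=> i j k l; have := curv_bianchi TC i j k l.
rewrite (rot j l k i) !(rot i j k l); lra.
Qed.

Definition sectional i j := T i j i j.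

Lemma second_kind_sym_delta i j :
  curvature_second_kind T (sym_delta R i j) (sym_delta R i j) = sectional i j *+ 2.
Proof.
rewrite /sym_delta !(second_kindDl, second_kindDr) !second_kind_delta.
rewrite !curv_diag12 !add0r addr0 mulr2n /sectional; congr (_ + _).
by rewrite a12 a34 opprK.
Qed.

End AlgebraicCurvature.

(** * Vanishing of split curvature tensors *)

Section SplitPsd.
Variables (R : realType) (n1 n2 : nat).
Variable T : 'I_(n1 + n2) -> 'I_(n1 + n2) -> 'I_(n1 + n2) -> 'I_(n1 + n2) -> R.
Hypothesis TC : algebraic_curvature T.
Hypotheses (n1_gt0 : (0 < n1)%N) (n2_gt0 : (0 < n2)%N).
Hypothesis Tsplit : split_tensor T.
Hypothesis Tpsd : forall B, traceless_symmetric B -> 0 <= curvature_second_kind T B B.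
Let a12 := curv_anti12 TC.
Let a34 := curv_anti34 TC.
Local Notation csk := (curvature_second_kind T).

Lemma sectional_ge0 i j : 0 <= sectional T i j.
Proof.
have [->|ij] := eqVneq i j; first by rewrite /sectional curv_diag12.
have := Tpsd (sym_deltaP R ij); rewrite second_kind_sym_delta // mulr2n; lra.
Qed.

Lemma second_kind_diag (b : 'rV[R]_(n1 + n2)) :
  csk (diag_mx b) (diag_mx b) = - \sum_i \sum_j b 0 i * b 0 j * sectional T i j.
Proof.
rewrite /curvature_second_kind raddf_sum; apply: eq_bigr => i _.
rewrite raddf_sum; apply: eq_bigr => j _ /=.
rewrite (bigD1 j) //= (bigD1 i) //= !mxE !eqxx !big1 ?addr0.
- rewrite !mulr1n /sectional (a34 i j j i); ring.
- by move=> k kj; rewrite big1 // => l _;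
  rewrite [diag_mx b j k]mxE eq_sym (negbTE kj) mulr0.
- by move=> l li; rewrite !mxE eq_sym (negbTE li) mulr0 mul0r.
Qed.

(** On n2 g1 - n1 g2 the form is minus the sum of b_i b_j sec(i, j), where b_i b_j > 0
    whenever i and j are in the same factor and sec(i, j) = 0 otherwise. The sum is at the
    same time nonpositive and a sum of nonnegative terms. *)
Lemma sectional_eq0 i j : sectional T i j = 0.
Proof.
(* n2 g1 - n1 g2, traceless because dim V1 = n1 and dim V2 = n2. *)
pose b : 'rV[R]_(n1 + n2) := \row_i if in_first i then n2%:R else - n1%:R.
have b_neq0 k : b 0 k != 0.
  by rewrite mxE; case: ifP; rewrite ?oppr_eq0 pnatr_eq0 -lt0n.
have bS : traceless_symmetric (diag_mx b).
  split; first by rewrite tr_diag_mx.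
  rewrite mxtrace_diag big_split_ord /=.
  under eq_bigr do rewrite mxE in_first_lshift.
  under [X in _ + X]eq_bigr do rewrite mxE in_first_rshift.
  by rewrite !sumr_const !card_ord mulNrn -[X in X - _]mulr_natl -[X in _ - X]mulr_natl
    mulrC subrr.
have term_ge0 k l : 0 <= b 0 k * b 0 l * sectional T k l.
  have [kl|kl] := eqVneq (in_first l) (in_first k); last first.
    by rewrite /sectional Tsplit ?mulr0 // (negbTE kl).
  rewrite (_ : b 0 l = b 0 k); last by rewrite !mxE kl.
  by rewrite mulr_ge0 ?sectional_ge0 // -expr2 sqr_ge0.
have sum0 : \sum_k \sum_l b 0 k * b 0 l * sectional T k l = 0.
  apply/eqP; rewrite eq_le; apply/andP; split.
    by rewrite -oppr_ge0 -second_kind_diag Tpsd.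
  by apply: sumr_ge0 => k _; exact: sumr_ge0.
have := psumr_eq0P (fun k _ => sumr_ge0 _ (fun l _ => term_ge0 k l)) sum0.
move=> /(_ i isT) /psumr_eq0P => /(_ (fun l _ => term_ge0 i l)) /(_ j isT) /eqP.
by rewrite !mulf_eq0 !(negbTE (b_neq0 _)) => /eqP.
Qed.

(** [psd_isotropic_ker] for the form on the traceless symmetric matrices. *)
Lemma second_kind_isotropic_ker B C : traceless_symmetric B -> traceless_symmetric C ->
  csk B B = 0 -> csk B C = 0.
Proof.
move=> [sB tB] [sC tC] B0.
apply: (@quadratic_ge0_linear_coef0 _ _ (csk C C)) => t.
have : traceless_symmetric (B + t *: C).
  by split; rewrite linearD linearZ /= ?sB ?sC // tB tC mulr0 addr0.
move=> /Tpsd; rewrite !(second_kindDl, second_kindZl, second_kindDr, second_kindZr) B0.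
rewrite (second_kindC a12 a34 C B) mulr2n; lra.
Qed.

(** All the tensors e_i . e_j and e_i^2 - e_j^2 are isotropic, hence in the kernel. Pairing
    e_p . e_s with e_q . e_r gives T p q r s + T p r q s = 0, first for p != s and q != r and
    then, by means of e_p^2 - e_r^2, in all cases; the Bianchi identity does the rest. *)
Lemma split_psd_curv_eq0 i j k l : T i j k l = 0.
Proof.
have ps := curv_pair_sym TC.
have T1331 p r s : T p r s p = 0.
  have [->|rs] := eqVneq r s.
    by rewrite a34 -[T p s p s]/(sectional T p s) sectional_eq0 oppr0.
  have [->|pr] := eqVneq p r; first by rewrite curv_diag12.
  (* The form takes the value 2 sec(p, r) = 0 on e_p^2 - e_r^2. *)
  have BS : traceless_symmetric (delta_mx p p - delta_mx r r : 'M[R]_(n1 + n2)).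
    by split; rewrite linearB /= ?trmx_delta // !trace_delta_mx !eqxx subrr.
  have := second_kind_isotropic_ker BS (sym_deltaP R rs).
  rewrite -scaleN1r /sym_delta !(second_kindDl, second_kindDr, second_kindZl,
    second_kindZr) !second_kind_delta.
  rewrite !(curv_diag12 TC) !(curv_diag34 TC).
  have := sectional_eq0 p r; have := sectional_eq0 r p; have := a34 p r r p;
    have := a34 r p p r.
  have -> : T p s r p = T p r s p by rewrite ps a12 a34 opprK.
  rewrite /sectional => h1 h2 h3 h4 ker; have := ker _; clear -h1 h2 h3 h4 => ker.
  lra.
have a23 p q r s : T p q r s = - T p r q s.
  have [->|ps'] := eqVneq p s; first by rewrite !T1331 oppr0.
  have [->|qr] := eqVneq q r.
    have := T1331 r p s; rewrite a12 a34 opprK => ->; by rewrite oppr0.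
  have := second_kind_isotropic_ker (sym_deltaP R ps') (sym_deltaP R qr).
  rewrite second_kind_sym_delta // sectional_eq0 mul0rn => /(_ erefl).
  rewrite /sym_delta !(second_kindDl, second_kindDr) !second_kind_delta.
  have -> : T s q r p = T p r q s by rewrite ps a12 a34 opprK.
  have -> : T s r q p = T p q r s by rewrite ps a12 a34 opprK.
  lra.
exact: curv_eq0_of_anti23.
Qed.
End SplitPsd.

(** * Continuous partial derivatives and Schwarz's theorem *)

Section LineDerivative.
Variables (R : realType) (V : normedModType R) (f : V -> R).
Implicit Types (y v : V) (s a : R).

Lemma line_growth_rate y v s :
  (fun h : R => h^-1 *: (f (y + (h *: (1 : R) + s) *: v) - f (y + s *: v))) =
  (fun h : R => h^-1 *: (f (h *: v + (y + s *: v)) - f (y + s *: v))).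
Proof.
apply/funext => h; congr (_ *: (f _ - _)).
by rewrite [h *: 1]mulr1 scalerDl addrCA.
Qed.

Lemma derivable_along_line y v s : derivable f (y + s *: v) v ->
  derivable (fun t : R => f (y + t *: v)) s 1.
Proof. by rewrite /derivable -line_growth_rate. Qed.

Lemma derive_along_line y v s :
  'D_1 (fun t : R => f (y + t *: v)) s = 'D_v f (y + s *: v).
Proof. by rewrite /derive -line_growth_rate. Qed.

Lemma line_mean_value y v a :
  (forall s, `|s| <= `|a| -> derivable f (y + s *: v) v) ->
  exists2 s, `|s| <= `|a| & f (y + a *: v) - f y = 'D_v f (y + s *: v) * a.
Proof.
move=> fd; pose g := fun t : R => f (y + t *: v).
have gd s : `|s| <= `|a| -> derivable g s 1 by move=> /fd /derivable_along_line.
have g' s : `|s| <= `|a| -> is_derive s 1 g ('D_v f (y + s *: v)).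
  by move=> sa; rewrite -derive_along_line; apply/derivableP/gd.
have g0 : g 0 = f y by rewrite /g scale0r addr0.
have [a0|a0] := leP 0 a.
- have in0a s : s \in `[0, a] -> `|s| <= `|a|.
    by rewrite in_itv /= => /andP[s0 sa]; rewrite !ger0_norm.
  have [||s /in0a sa E] := @MVT_segment R g (fun s => 'D_v f (y + s *: v)) 0 a a0.
  + by move=> s /subset_itv_oo_cc /in0a; exact: g'.
  + by apply: derivable_within_continuous => s /in0a /gd.
  by exists s => //; move: E; rewrite g0 subr0.
- have ina0 s : s \in `[a, 0] -> `|s| <= `|a|.
    by rewrite in_itv /= => /andP[s0 sa]; rewrite !ler0_norm ?lerN2 // ltW.
  have [||s /ina0 sa E] := @MVT_segment R g (fun s => 'D_v f (y + s *: v)) a 0 (ltW a0).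
  + by move=> s /subset_itv_oo_cc /ina0; exact: g'.
  + by apply: derivable_within_continuous => s /ina0 /gd.
  exists s => //; move: E; rewrite g0 sub0r /g mulrN => E; lra.
Qed.

End LineDerivative.

Section ContinuousPartials.
Variables (R : realType) (n : nat).
Implicit Types (f : 'rV[R]_n -> R) (x h : 'rV[R]_n).

(** The vertices of the path from 0 to h that runs parallel to the coordinate axes. *)
Definition trunc_row (k : nat) h : 'rV[R]_n :=
  \row_i (if (i < k)%N then h 0 i else 0).

Lemma trunc_rowS h (k : 'I_n) :
  trunc_row k.+1 h = trunc_row k h + h 0 k *: delta_mx 0 k.
Proof.
apply/rowP => i; rewrite !mxE /= ltnS leq_eqVlt eq_sym.
have [->|ik] := eqVneq i k; first by rewrite eqxx ltnn /= mulr1 add0r.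
by rewrite (negbTE (_ : k != i :> nat)) ?mulr0 ?addr0 // eq_sym.
Qed.

Lemma norm_trunc_row h (k : 'I_n) s : `|s| <= `|h 0 k| ->
  `|trunc_row k h + s *: delta_mx 0 k| <= `|h|.
Proof.
move=> sh; rewrite {1}/Num.Def.normr /= mx_normrE.
have hle (i : 'I_n) : `|h 0 i| <= `|h|.
  by rewrite {2}/Num.Def.normr /= mx_normrE (le_bigmax _ (fun i : 'I_1 * 'I_n =>
    `|h i.1 i.2|) (0, i)).
apply: bigmax_le => // -[i j] _ /=; rewrite ord1 !mxE eqxx /=.
have [->|jk] := eqVneq j k; first by rewrite ltnn add0r mulr1 (le_trans sh).
by rewrite mulr0 addr0; case: ifP; rewrite ?normr0.
Qed.

(** The increment from x to x + h is split along the path [trunc_row]; on each of its edges the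
    mean value theorem gives a partial derivative at a point close to x. *)
Lemma differentiable_of_continuous_partials f x :
  (\forall y \near x, forall i, derivable f y (delta_mx 0 i)) ->
  (forall i, {for x, continuous (partial i f)}) ->
  differentiable f x.
Proof.
move=> fd fc.
(* The candidate for the differential. *)
pose L h := dotp h (\row_i partial i f x).
have Llin : linear L by move=> a u v; rewrite /L dotpDl dotpZl.
pose LM := GRing.isLinear.Build _ _ _ _ _ Llin.
pose Ll : {linear 'rV[R]_n -> R} := HB.pack L LM.
have Lc : continuous Ll.
  have -> : Ll = (fun h : 'rV[R]_n => \sum_i h 0 i * partial i f x) :> (_ -> _).
    by apply/funext => h; rewrite /= /L dotpE; apply: eq_bigr => i _; rewrite mxE.
  apply: continuous_big => [|i _ h]; first exact: add_continuous.
  apply: (@continuousM R _ (fun v : 'rV[R]_n => v 0 i)); first exact: coord_continuous.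
  exact: cst_continuous.
suff E : (f : _ -> R^o) \o shift x = cst (f x) + (Ll : _ -> R^o) +o_ (0 : 'rV[R]_n) id.
  by apply/diff_locallyP; rewrite (diff_unique Lc E).
apply/eqaddoP => e e0.
have e'0 : 0 < e / n.+1%:R by rewrite divr_gt0.
have : \forall y \near x, (forall i, derivable f y (delta_mx 0 i)) /\
     (forall i, `|partial i f x - partial i f y| <= e / n.+1%:R).
  apply: filterI => //; apply: (@filter_forall _ _ (fun (i : 'I_n) (y : 'rV[R]_n) =>
    `|partial i f x - partial i f y| <= e / n.+1%:R) _ (nbhs_filter x)) => i.
  exact: (cvgrPdist_le _ _).1 (fc i) _ e'0.
move=> /nbhs_ballP[d /= d0 dP].
apply/nbhs_ballP; exists d => //= h; rewrite -ball_normE /= sub0r normrN => hd.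
have near_x k : `|k| <= `|h| -> ball x d (k + x).
  by move=> kh; rewrite -ball_normE /= opprD addrCA subrr addr0 normrN (le_lt_trans kh).
have step (k : 'I_n) : `|f (trunc_row k.+1 h + x) - f (trunc_row k h + x) -
    h 0 k * partial k f x| <= e / n.+1%:R * `|h|.
  have hk : `|h 0 k| <= `|h|.
    by rewrite {2}/Num.Def.normr /= mx_normrE (le_bigmax _ (fun i : 'I_1 * 'I_n =>
      `|h i.1 i.2|) (0, k)).
  have -> : trunc_row k.+1 h + x = trunc_row k h + x + h 0 k *: delta_mx 0 k.
    by rewrite trunc_rowS addrAC.
  have [s sh|s sh ->] := @line_mean_value R _ f (trunc_row k h + x) (delta_mx 0 k) (h 0 k).
    by rewrite addrAC; apply: (dP _ (near_x _ (norm_trunc_row sh))).1.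
  rewrite mulrC -mulrBr normrM mulrC ler_pM // distrC addrAC.
  exact: (dP _ (near_x _ (norm_trunc_row sh))).2.
have -> : (f \o shift x - (cst (f x) + Ll)) h =
  \sum_(k < n) (f (trunc_row k.+1 h + x) - f (trunc_row k h + x) - h 0 k * partial k f x).
  rewrite sumrB -(big_mkord xpredT (fun k => f (trunc_row k.+1 h +
    x) - f (trunc_row k h + x))).
  rewrite telescope_sumr //.
  have -> : trunc_row n h = h by apply/rowP => i; rewrite mxE ltn_ord.
  have -> : trunc_row 0 h = 0 by apply/rowP => i; rewrite !mxE.
  rewrite -[LHS]/(f (h + x) - (f x + L h)) add0r opprD addrA; congr (_ - _).
  by rewrite /L dotpE; apply: eq_bigr => k _; rewrite mxE.
rewrite (le_trans (ler_norm_sum _ _ _)) //.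
rewrite (le_trans (ler_sum _ (fun k _ => step k))) // sumr_const card_ord.
rewrite -[leLHS]mulr_natl mulrA ler_wpM2r // mulrCA ger_pMr // ler_pdivrMr // mul1r
  ler_nat //.
Qed.

End ContinuousPartials.

Section Schwarz.
Variables (R : realType) (V : normedModType R).
Implicit Types (f : V -> R) (x y u v c : V).

Lemma shift_growth_rate f y v c :
  (fun h : R => h^-1 *: (f (h *: v + y + c) - f (y + c))) =
  (fun h : R => h^-1 *: (f (h *: v + (y + c)) - f (y + c))).
Proof. by apply/funext => h; rewrite addrA. Qed.

Lemma derivable_shift f y v c :
  derivable f (y + c) v -> derivable (fun z => f (z + c)) y v.
Proof. by rewrite /derivable -shift_growth_rate. Qed.

Lemma derive_translate f y v c : 'D_v (fun z => f (z + c)) y = 'D_v f (y + c).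
Proof. by rewrite /derive -shift_growth_rate. Qed.

Lemma differentiable_linear_approx f x : differentiable f x ->
  forall e, 0 < e -> \forall h \near (0 : V), `|f (h + x) - f x - 'd f x h| <= e * `|h|.
Proof.
move=> /diff_locallyP[_ /eqaddoP fx] e e0; have := fx e e0.
by apply: filterS => h; rewrite -[X in `|X|]/(f (h + x) - (f x + 'd f x h)) opprD addrA.
Qed.

(** The expression in f is symmetric in u and v, so that the limit of its quotient by t^2 is
    both mixed derivatives. *)
Lemma second_difference f x u v :
  (\forall y \near x, derivable f y u) -> differentiable ('D_u f) x ->
  forall e, 0 < e -> \forall t \near (0 : R),
    `|f (x + t *: u + t *: v) - f (x + t *: u) - f (x + t *: v) + f x
      - t ^+ 2 * 'D_v ('D_u f) x| <= e * t ^+ 2.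
Proof.
move=> fd Dfd e e0; pose C := 2 * (`|u| + `|v|) + 1.
have C0 : 0 < C by rewrite /C ltr_wpDl // mulr_ge0 // addr_ge0.
have e'0 : 0 < e / C by rewrite divr_gt0.
have /nbhs_ballP[d1 /= d10 fd1] := fd.
have /nbhs_ballP[d2 /= d20 fd2] := differentiable_linear_approx Dfd e'0.
pose d := Num.min d1 d2.
have d0 : 0 < d by rewrite lt_min d10.
apply/nbhs_ballP; exists (d / C); first by rewrite /= divr_gt0.
move=> t; rewrite -ball_normE /= sub0r normrN ltr_pdivlMr // => td.
have small s r : `|s| <= `|t| -> `|r| <= `|t| -> `|s *: u + r *: v| < d.
  move=> st rt; apply: le_lt_trans td; apply: le_trans (ler_normD _ _) _.
  rewrite !normrZ /C mulrDr mulr1 mulrCA mulrDr.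
  have := ler_wpM2r (normr_ge0 u) st; have := ler_wpM2r (normr_ge0 v) rt.
  have := mulr_ge0 (normr_ge0 t) (normr_ge0 u).
  have := mulr_ge0 (normr_ge0 t) (normr_ge0 v).
  have := normr_ge0 t; lra.
have near1 w : `|w| < d -> derivable f (x + w) u.
  move=> wd; apply: fd1; rewrite -ball_normE /= opprD addrA subrr sub0r normrN.
  by apply: lt_le_trans wd _; rewrite ge_min lexx.
(* The difference is the increment of g along t u; apply the mean value theorem. *)
pose g y := f (y + t *: v) - f y.
have gd s : `|s| <= `|t| -> derivable g (x + s *: u) u.
  move=> st; apply: derivableB; last first.
    by apply: near1; have := small s 0 st; rewrite scale0r addr0 normr0; apply.
  by apply: derivable_shift; rewrite -addrA; apply: near1; exact: small.
have [s st E] := line_mean_value gd.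
have -> : f (x + t *: u + t *: v) - f (x + t *: u) - f (x + t *: v) + f x =
   g (x + t *: u) - g x by rewrite /g; ring.
have su := small s 0 st; rewrite scale0r addr0 normr0 in su.
have stv := small s t st (lexx _).
have approx w : `|w| < d ->
    `|'D_u f (w + x) - 'D_u f x - 'd ('D_u f) x w| <= e / C * `|w|.
  move=> wd; apply: fd2; rewrite -ball_normE /= sub0r normrN.
  by apply: lt_le_trans wd _; rewrite ge_min lexx orbT.
have Dg : 'D_u g (x + s *: u) = 'D_u f (s *: u + t *: v + x) - 'D_u f (s *: u + x).
  rewrite deriveB; first last.
  - by apply: near1; exact: su.
  - by apply: derivable_shift; rewrite -addrA; apply: near1.
  by rewrite derive_translate -addrA addrC (addrC x).
have lin : 'd ('D_u f) x (s *: u + t *: v) - 'd ('D_u f) x (s *: u) = t * 'D_v ('D_u f) x.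
  by rewrite linearD addrC addKr linearZ deriveE.
rewrite E Dg expr2.
have -> : ('D_u f (s *: u + t *: v + x) - 'D_u f (s *: u + x)) * t - t * t * 'D_v ('D_u f) x
  = t * (('D_u f (s *: u + t *: v + x) - 'D_u f x - 'd ('D_u f) x (s *: u + t *: v))
       - ('D_u f (s *: u + x) - 'D_u f x - 'd ('D_u f) x (s *: u))).
  by rewrite -(mulrA t t) -lin; ring.
rewrite normrM -[t * t]expr2 -real_normK ?num_real // expr2 mulrCA ler_wpM2l //.
apply: le_trans (ler_normB _ _) _.
apply: le_trans (lerD (approx _ stv) (approx _ (su (normr_ge0 _)))) _.
have -> : e * `|t| = e / C * (C * `|t|) by rewrite mulrA divfK // lt0r_neq0.
rewrite -mulrDr ler_wpM2l ?(ltW e'0) //.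
apply: le_trans (lerD (ler_normD _ _) (lexx _)) _; rewrite !normrZ.
have := ler_wpM2r (normr_ge0 u) st.
have := mulr_ge0 (normr_ge0 t) (normr_ge0 v).
have := normr_ge0 t; rewrite /C; nra.
Qed.

Lemma derive_schwarz f x u v :
  (\forall y \near x, derivable f y u) -> (\forall y \near x, derivable f y v) ->
  differentiable ('D_u f) x -> differentiable ('D_v f) x ->
  'D_v ('D_u f) x = 'D_u ('D_v f) x.
Proof.
move=> fu fv du dv; apply/eqP; rewrite -subr_eq0 -normr_le0.
apply/ler_addgt0Pl => e e0; rewrite addr0.
have e2 : 0 < e / 2 by rewrite divr_gt0.
have /nbhs_ballP[d1 /= d10 dP1] := second_difference v fu du e2.
have /nbhs_ballP[d2 /= d20 dP2] := second_difference u fv dv e2.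
pose d := Num.min d1 d2.
have d0 : 0 < d by rewrite lt_min d10.
have dd : d / 2 < d by lra.
have inb (r : R) : d <= r -> ball (0 : R) r (d / 2).
  move=> dr; rewrite -ball_normE /= sub0r normrN ger0_norm ?divr_ge0 ?(ltW d0) //.
  exact: lt_le_trans dr.
have dd1 : d <= d1 by rewrite ge_min lexx.
have dd2 : d <= d2 by rewrite ge_min lexx orbT.
move: (dP1 _ (inb _ dd1)) (dP2 _ (inb _ dd2)).
set t := d / 2; have t0 : 0 < t ^+ 2 by rewrite exprn_gt0 // divr_gt0.
rewrite (_ : f (x + t *: v + t *: u) - f (x + t *: v) - f (x + t *: u) + f x
  = f (x + t *: u + t *: v) - f (x + t *: u) - f (x + t *: v) + f x); last first.
  by rewrite (addrAC x); ring.
set D := _ + f x; set a := 'D_v _ _; set b := 'D_u _ _ => h1 h2.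
rewrite -(ler_pM2l t0) -[X in X * _](ger0_norm (ltW t0)) -normrM.
have -> : t ^+ 2 * (a - b) = (D - t ^+ 2 * b) - (D - t ^+ 2 * a) by ring.
apply: le_trans (ler_normB _ _) _ .
apply: le_trans (lerD h2 h1) _.
by rewrite -mulrDl -splitr mulrC.
Qed.

End Schwarz.

(** * Calculus of partial derivatives *)

Section SmoothOn.
Variables (R : realType) (n : nat) (U : set 'rV[R]_n).
Hypothesis Uopen : open U.
Implicit Types (f : 'rV[R]_n -> R) (x : 'rV[R]_n).

Lemma smooth_on_partial f i : smooth_on U f -> smooth_on U (partial i f).
Proof. by move=> fs s x Ux; have := fs (rcons s i) x Ux; rewrite foldr_rcons. Qed.

Lemma smooth_on_differentiable f x : smooth_on U f -> U x -> differentiable f x.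
Proof.
move=> fs Ux; apply: differentiable_of_continuous_partials.
  have : nbhs x U by apply: open_nbhs_nbhs.
  by apply: filterS => y Uy i; exact: (fs [::] y Uy).2.
by move=> i; exact: (fs [:: i] x Ux).1.
Qed.

Lemma smooth_on_partialC f i j x : smooth_on U f -> U x ->
  partial i (partial j f) x = partial j (partial i f) x.
Proof.
move=> fs Ux; have xU : nbhs x U by apply: open_nbhs_nbhs.
apply: derive_schwarz.
- by apply: filterS xU => y Uy; exact: (fs [::] y Uy).2.
- by apply: filterS xU => y Uy; exact: (fs [::] y Uy).2.
- exact/smooth_on_differentiable/Ux/smooth_on_partial.
- exact/smooth_on_differentiable/Ux/smooth_on_partial.
Qed.

End SmoothOn.

Lemma differentiable_near (R : realType) (V : normedModType R) (f g : V -> R)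
    (x : V) : (\forall y \near x, f y = g y) ->
  differentiable f x -> differentiable g x.
Proof.
move=> fg df; have fgx := nbhs_singleton fg.
have dc : continuous ('d f x) by exact: diff_continuous.
suff E : (g : _ -> R^o) \o shift x = cst (g x) + ('d f x : _ -> R^o) +o_ (0 : V) id.
  by apply/diff_locallyP; rewrite (diff_unique dc E).
apply/eqaddoP => e e0.
have fg0 : \forall h \near (0 : V), f (h + x) = g (h + x).
  by move: fg; rewrite (near_shift 0) /=; apply: filterS => h; rewrite /= subr0.
have flin := differentiable_linear_approx df e0.
near=> h; have fgh : f (h + x) = g (h + x) by near: h.
have : `|f (h + x) - f x - 'd f x h| <= e * `|h| by near: h.
by rewrite fgh fgx -[X in _ -> `|X| <= _]/(g (h + x) - (g x + 'd f x h)) opprD addrA.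
Unshelve. all: by end_near. Qed.

Section PartialRules.
Variables (R : realType) (n : nat).
Implicit Types (f g : 'rV[R]_n -> R) (x : 'rV[R]_n).

Lemma partialD f g x i : differentiable f x -> differentiable g x ->
  partial i (fun y => f y + g y) x = partial i f x + partial i g x.
Proof. by move=> df dg; rewrite /partial deriveD //; exact: diff_derivable. Qed.

Lemma partialM f g x i : differentiable f x -> differentiable g x ->
  partial i (fun y => f y * g y) x = partial i f x * g x + f x * partial i g x.
Proof.
move=> df dg; rewrite /partial deriveM; [|exact: diff_derivable..].
by rewrite addrC [g x *: _]mulrC.
Qed.

Lemma differentiable_fsum (I : finType) (F : I -> 'rV[R]_n -> R) x :
  (forall k, differentiable (F k) x) -> differentiable (fun y => \sum_k F k y) x.
Proof.
move=> dF; elim: (index_enum I) => [|k s IH].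
  by under eq_fun do rewrite big_nil; exact: differentiable_cst.
by under eq_fun do rewrite big_cons; exact: differentiableD.
Qed.

Lemma differentiable_fprod (I : finType) (F : I -> 'rV[R]_n -> R) x :
  (forall k, differentiable (F k) x) -> differentiable (fun y => \prod_k F k y) x.
Proof.
move=> dF; elim: (index_enum I) => [|k s IH].
  by under eq_fun do rewrite big_nil; exact: differentiable_cst.
by under eq_fun do rewrite big_cons; exact: differentiableM.
Qed.

Lemma partial_sum (I : finType) (F : I -> 'rV[R]_n -> R) x i :
  (forall k, differentiable (F k) x) ->
  partial i (fun y => \sum_k F k y) x = \sum_k partial i (F k) x.
Proof.
move=> dF.
suff H (s : seq I) : differentiable (fun y => \sum_(k <- s) F k y) x /\
    partial i (fun y => \sum_(k <- s) F k y) x = \sum_(k <- s) partial i (F k) x.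
  exact: (H _).2.
elim: s => [|k s [IHd IHe]].
  rewrite big_nil; under eq_fun do rewrite big_nil.
  by split; [exact: differentiable_cst|exact: derive_cst].
rewrite big_cons; under eq_fun do rewrite big_cons.
by split; [exact: differentiableD|rewrite partialD ?IHe].
Qed.

Lemma partial_near f g x i : (\forall y \near x, f y = g y) ->
  partial i f x = partial i g x.
Proof. exact: near_eq_derive. Qed.

End PartialRules.

Section ChainRule.
Variables (R : realType) (m n : nat).
Variables (phi : 'rV[R]_m -> 'rV[R]_n) (x : 'rV[R]_m).
Hypothesis dphi : forall a, differentiable (fun y => phi y 0 a) x.

Lemma differentiable_rowP : differentiable phi x.
Proof.
have -> : phi = \sum_a (fun y => phi y 0 a *: delta_mx 0 a).
  by apply/funext => y; rewrite fct_sumE [LHS]row_sum_delta.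
by apply: differentiable_sum => a; exact: differentiableZl.
Qed.

Lemma derive_row v a : ('D_v phi x) 0 a = 'D_v (fun y => phi y 0 a) x.
Proof. by rewrite derive_mx ?mxE //; exact: diff_derivable differentiable_rowP. Qed.

Lemma jacobianE i a : jacobian phi x i a = partial i (fun y => phi y 0 a) x.
Proof.
rewrite !mxE -deriveE ?derive_row //; exact: differentiable_rowP.
Qed.

Lemma partial_comp (f : 'rV[R]_n -> R) i : differentiable f (phi x) ->
  partial i (fun y => f (phi y)) x =
  \sum_a jacobian phi x i a * partial a f (phi x).
Proof.
move=> df; rewrite /partial deriveE; last exact: differentiable_comp differentiable_rowP df.
rewrite diff_comp //=; last exact: differentiable_rowP.
rewrite [X in 'd f _ X](row_sum_delta ('d phi x (delta_mx 0 i))) linear_sum.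
apply: eq_bigr => a _; rewrite linearZ /= deriveE // mxE //.
Qed.

Lemma differentiable_fcomp (f : 'rV[R]_n -> R) : differentiable f (phi x) ->
  differentiable (fun y => f (phi y)) x.
Proof. by move=> df; exact: differentiable_comp differentiable_rowP df. Qed.

End ChainRule.

(** * Matrix-valued functions *)

Section MatrixCalculus.
Variables (R : realType) (n : nat).
Implicit Types (x : 'rV[R]_n).

Definition differentiable_mx p q (A : 'rV[R]_n -> 'M[R]_(p, q)) x :=
  forall a b, differentiable (fun y => A y a b) x.

Definition partial_mx p q (i : 'I_n) (A : 'rV[R]_n -> 'M[R]_(p, q)) x : 'M[R]_(p, q) :=
  \matrix_(a, b) partial i (fun y => A y a b) x.

Lemma partial_mx_near p q i (A B : 'rV[R]_n -> 'M[R]_(p, q)) x :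
  (\forall y \near x, A y = B y) -> partial_mx i A x = partial_mx i B x.
Proof.
move=> AB; apply/matrixP => a b; rewrite !mxE; apply: partial_near.
by apply: filterS AB => y ->.
Qed.

Lemma differentiable_mxM p q r (A : 'rV[R]_n -> 'M[R]_(p, q)) (B : 'rV[R]_n ->
  'M[R]_(q, r)) x :
  differentiable_mx A x -> differentiable_mx B x -> differentiable_mx (fun y =>
    A y *m B y) x.
Proof.
move=> dA dB a b; under eq_fun do rewrite mxE.
by apply: differentiable_fsum => c; exact: differentiableM.
Qed.

Lemma partial_mxM p q r i (A : 'rV[R]_n -> 'M[R]_(p, q)) (B : 'rV[R]_n -> 'M[R]_(q, r)) x :
  differentiable_mx A x -> differentiable_mx B x ->
  partial_mx i (fun y => A y *m B y) x = partial_mx i A x *m B x + A x *m partial_mx i B x.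
Proof.
move=> dA dB; apply/matrixP => a b; rewrite !mxE.
under [in LHS]eq_fun do rewrite mxE.
rewrite partial_sum => [|c]; last exact: differentiableM.
rewrite -big_split; apply: eq_bigr => c _; rewrite partialM // !mxE //.
Qed.

Lemma partial_mxD p q i (A B : 'rV[R]_n -> 'M[R]_(p, q)) x :
  differentiable_mx A x -> differentiable_mx B x ->
  partial_mx i (fun y => A y + B y) x = partial_mx i A x + partial_mx i B x.
Proof.
move=> dA dB; apply/matrixP => a b; rewrite !mxE -partialD //.
by congr partial; apply/funext => y; rewrite mxE.
Qed.

Lemma differentiable_mx_tr p q (A : 'rV[R]_n -> 'M[R]_(p, q)) x :
  differentiable_mx A x -> differentiable_mx (fun y => (A y)^T) x.
Proof. by move=> dA a b; under eq_fun do rewrite mxE. Qed.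

Lemma partial_mx_tr p q i (A : 'rV[R]_n -> 'M[R]_(p, q)) x :
  partial_mx i (fun y => (A y)^T) x = (partial_mx i A x)^T.
Proof.
apply/matrixP => a b; rewrite !mxE; congr partial.
by apply/funext => y; rewrite mxE.
Qed.

Lemma differentiable_det p (A : 'rV[R]_n -> 'M[R]_p) x :
  differentiable_mx A x -> differentiable (fun y => \det (A y)) x.
Proof.
move=> dA; apply: differentiable_fsum => s.
by apply: differentiableM; [exact: differentiable_cst|exact: differentiable_fprod].
Qed.

(** By Cramer's rule. *)
Lemma differentiable_mx_invmx p (A : 'rV[R]_n -> 'M[R]_p) x :
  differentiable_mx A x -> (\forall y \near x, A y \in unitmx) ->
  differentiable_mx (fun y => invmx (A y)) x.
Proof.
move=> dA uA a b.
apply: (@differentiable_near _ _ (fun y => (\det (A y))^-1 * cofactor (A y) b a)).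
  by apply: filterS uA => y uy; rewrite /invmx uy !mxE.
apply: differentiableM.
  apply: differentiableV; first exact: differentiable_det.
  by have := nbhs_singleton uA; rewrite unitmxE unitfE.
apply: differentiableM; first exact: differentiable_cst.
by apply: differentiable_det => c d; under eq_fun do rewrite !mxE; exact: dA.
Qed.

End MatrixCalculus.

(** * The Levi-Civita connection in coordinates *)

Record metric_on (R : realType) (n : nat) (U : set 'rV[R]_n)
    (g : 'rV[R]_n -> 'M[R]_n) : Prop := MetricOn {
  metric_on_smooth : forall a b, smooth_on U (fun y => g y a b);
  metric_on_sym : forall x, U x -> (g x)^T = g x;
  metric_on_unit : forall x, U x -> g x \in unitmx }.

Arguments metric_on_smooth {R n U g} _ a b.
Arguments metric_on_sym {R n U g} _ [x] _.
Arguments metric_on_unit {R n U g} _ [x] _.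

(** The first Bianchi identity for the curvature of a connection with matrices C i and
    derivatives D i j = d_i (C j): it only depends on the symmetry of the Christoffel symbols. *)
Lemma torsionfree_bianchi (R : realType) (n : nat)
    (D : 'I_n -> 'I_n -> 'M[R]_n) (C : 'I_n -> 'M[R]_n)
    (F := fun i j => D i j - D j i + C j *m C i - C i *m C j) :
  (forall i j k m, D i j k m = D i k j m) ->
  (forall i k m, C i k m = C k i m) ->
  forall i j l m, F i j l m + F j l i m + F l i j m = 0.
Proof.
move=> Dsym Csym i j l m.
have Qsym i' j' k' : (C i' *m C j') k' m = (C k' *m C j') i' m.
  by rewrite [LHS]mxE [RHS]mxE; apply: eq_bigr => p _; rewrite (Csym i').
have entry (A B A' B' : 'M[R]_n) a b :
    (A - B + A' - B') a b = A a b - B a b + A' a b - B' a b.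
  by rewrite !mxE.
rewrite /F !entry (Dsym i j l) (Dsym j i l) (Dsym l i j).
rewrite (Qsym j i l) (Qsym i j l) (Qsym j l i); ring.
Qed.

(** The integrability condition d_i d_j g = d_j d_i g for a connection that preserves the
    metric G, where A, B are the connection matrices and P, Q their derivatives: the left
    and right hand sides of the hypothesis are the two mixed derivatives of G. *)
Lemma skew_of_second_partials (R : realType) (n : nat) (P Q A B G : 'M[R]_n) :
  G^T = G ->
  (P *m G + B *m (A *m G + (A *m G)^T)) + (P *m G + B *m (A *m G + (A *m G)^T))^T =
  (Q *m G + A *m (B *m G + (B *m G)^T)) + (Q *m G + A *m (B *m G + (B *m G)^T))^T ->
  (P - Q + B *m A - A *m B) *m G + ((P - Q + B *m A - A *m B) *m G)^T = 0.
Proof.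
move=> sG.
set M1 := P *m G + _; set M2 := Q *m G + _ => E.
(* The terms B G A^T and A G B^T are transposes of each other, so they cancel. *)
have Z : (B *m G *m A^T)^T = A *m G *m B^T by rewrite !trmx_mul trmxK sG mulmxA.
have -> : (P - Q + B *m A - A *m B) *m G =
    M1 - M2 - (B *m G *m A^T) + A *m G *m B^T.
  rewrite /M1 /M2 !(trmx_mul A) !(trmx_mul B) sG !mulmxDr !mulmxA !mulmxDl !mulNmx.
  move: (P *m G) (Q *m G) (B *m A *m G) (A *m B *m G) (B *m G *m A^T) (A *m G *m B^T).
  by move=> a b c d e f; apply/matrixP => k l; rewrite !mxE; ring.
move: Z; set Y := B *m G *m A^T; set Y' := A *m G *m B^T => Z.
apply/matrixP => k l.
have := congr1 (fun M : 'M[R]_n => M k l) E.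
move: M1 M2 Y Y' Z {E} => M1 M2 Y Y' <-.
by rewrite !mxE => E; lra.
Qed.

Section Connection.
Variables (R : realType) (n : nat) (U : set 'rV[R]_n) (g : 'rV[R]_n -> 'M[R]_n).
Hypotheses (Uopen : open U) (gU : metric_on U g).
Implicit Types (x : 'rV[R]_n).

(** The matrix of nabla_i on the coordinate frame, acting on row vectors from the right: row k
    contains the components of nabla_i d_k. In this form the formulas of gauge theory apply. *)
Definition conn_mx i x : 'M[R]_n := \matrix_(k, m) christoffel g x m i k.

(** The curvature d A + A /\ A, with the products reversed because matrices act from the
    right. *)
Definition curv_mx i j x : 'M[R]_n :=
  partial_mx i (conn_mx j) x - partial_mx j (conn_mx i) x
  + conn_mx j x *m conn_mx i x - conn_mx i x *m conn_mx j x.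

Lemma near_dom x : U x -> \forall y \near x, U y.
Proof. by move=> Ux; apply: open_nbhs_nbhs. Qed.

Lemma metric_differentiable x : U x -> differentiable_mx g x.
Proof. by move=> Ux a b; apply: (smooth_on_differentiable Uopen _ Ux);
  exact: metric_on_smooth gU a b. Qed.

Lemma partial_metric_sym x i a b : U x ->
  partial i (fun y => g y a b) x = partial i (fun y => g y b a) x.
Proof.
move=> Ux; apply: partial_near; apply: filterS (near_dom Ux) => y Uy.
by rewrite -[in LHS](metric_on_sym gU Uy) mxE.
Qed.

Lemma conn_mx_differentiable x i : U x -> differentiable_mx (conn_mx i) x.
Proof.
move=> Ux k m; under eq_fun do rewrite mxE.
apply: differentiableM; first exact: differentiable_cst.
have dp j a b : differentiable (partial j (fun y => g y a b)) x.
  apply: (smooth_on_differentiable Uopen _ Ux); apply: smooth_on_partial;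
    exact: metric_on_smooth gU a b.
apply: differentiable_fsum => l; apply: differentiableM.
  apply: differentiable_mx_invmx; first exact: metric_differentiable.
  by apply: filterS (near_dom Ux) => y Uy; exact: metric_on_unit gU _ Uy.
by apply: differentiableB => //; exact: differentiableD.
Qed.

Lemma conn_mx_lowered x i k l : U x ->
  (conn_mx i x *m g x) k l = 2^-1 * (partial i (fun y => g y k l) x
    + partial k (fun y => g y i l) x - partial l (fun y => g y i k) x).
Proof.
move=> Ux; rewrite mxE.
pose S := fun p => partial i (fun y => g y k p) x
    + partial k (fun y => g y i p) x - partial p (fun y => g y i k) x.
transitivity (\sum_m \sum_p 2^-1 * (S p * (invmx (g x) p m * g x m l))).
  apply: eq_bigr => m _; rewrite mxE /christoffel -mulrA mulr_suml mulr_sumr.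
  apply: eq_bigr => p _; rewrite /S.
  have -> : invmx (g x) p m = invmx (g x) m p.
    by rewrite -[in RHS](metric_on_sym gU Ux) -trmx_inv [RHS]mxE.
  ring.
rewrite exchange_big (bigD1 l) //= [X in _ + X]big1 ?addr0; last first.
  move=> p pl; rewrite -!mulr_sumr.
  have := congr1 (fun M : 'M[R]_n => M p l) (mulVmx (metric_on_unit gU Ux)).
  by rewrite !mxE (negbTE pl) => ->; rewrite !mulr0.
rewrite -!mulr_sumr.
have := congr1 (fun M : 'M[R]_n => M l l) (mulVmx (metric_on_unit gU Ux)).
by rewrite !mxE eqxx => ->; rewrite mulr1.
Qed.

Lemma conn_mx_compat x i : U x ->
  partial_mx i g x = conn_mx i x *m g x + (conn_mx i x *m g x)^T.
Proof.
move=> Ux; apply/matrixP => k l; rewrite [RHS]mxE [X in _ + X]mxE.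
rewrite !conn_mx_lowered // (partial_metric_sym i l k Ux) mxE.
by field.
Qed.

Lemma conn_mx_torsionfree x i k m : U x -> conn_mx i x k m = conn_mx k x i m.
Proof.
move=> Ux; rewrite !mxE /christoffel; congr (_ * _); apply: eq_bigr => l _.
by congr (_ * _); rewrite (partial_metric_sym l i k Ux) [X in X - _]addrC.
Qed.

(** The Koszul formula: a torsion-free connection that preserves the metric is the
    Levi-Civita connection. All connections below are identified in this way. *)
Lemma conn_mx_unique x (A : 'I_n -> 'M[R]_n) : U x ->
  (forall i, partial_mx i g x = A i *m g x + (A i *m g x)^T) ->
  (forall i k m, A i k m = A k i m) -> forall i, A i = conn_mx i x.
Proof.
move=> Ux Acompat Atf i.
suff E : A i *m g x = conn_mx i x *m g x.
  by rewrite -[LHS](mulmxK (metric_on_unit gU Ux)) E mulmxK ?(metric_on_unit gU Ux).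
apply/matrixP => k l; rewrite conn_mx_lowered //.
have low i' k' l' : (A i' *m g x) k' l' = (A k' *m g x) i' l'.
  by rewrite !mxE; apply: eq_bigr => m _; rewrite Atf.
have comp i' k' l' : partial i' (fun y => g y k' l') x =
    (A i' *m g x) k' l' + (A i' *m g x) l' k'.
  by have := congr1 (fun M : 'M[R]_n => M k' l') (Acompat i'); rewrite mxE => ->;
    rewrite mxE [X in _ + X = _]mxE.
rewrite !comp (low k i l) (low k l i) (low l i k).
by field.
Qed.

Lemma curvature_endoE x m i j k : curvature_endo g x m i j k = curv_mx i j x k m.
Proof.
rewrite /curvature_endo /curv_mx !mxE.
have E i' j' : partial i' (fun y => christoffel g y m j' k) x =
    partial i' (fun y => conn_mx j' y k m) x.
  by congr partial; apply/funext => y; rewrite mxE.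
rewrite !E sumrB addrA; congr (_ + _ - _).
  by apply: eq_bigr => l _; rewrite !mxE.
by apply: eq_bigr => l _; rewrite !mxE.
Qed.

Lemma riemannE x i j k l : U x -> riemann g x i j k l = (curv_mx i j x *m g x) l k.
Proof.
move=> Ux; rewrite /riemann mxE; apply: eq_bigr => m _.
rewrite curvature_endoE mulrC; congr (_ * _).
by rewrite -[in LHS](metric_on_sym gU Ux) mxE.
Qed.

Lemma curv_mx_anti x i j : curv_mx j i x = - curv_mx i j x.
Proof.
rewrite /curv_mx; move: (partial_mx i _ x) (partial_mx j _ x) (_ *m _) (_ *m _) => P Q A B.
by rewrite opprB opprD opprB addrA [X in _ = X - _]addrC.
Qed.

Lemma curv_mx_bianchi x i j l m : U x ->
  curv_mx i j x l m + curv_mx j l x i m + curv_mx l i x j m = 0.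
Proof.
move=> Ux; apply: (@torsionfree_bianchi _ _ (fun i j =>
  partial_mx i (conn_mx j) x) (conn_mx ^~ x)).
  move=> i' j' k' m'; rewrite [LHS]mxE [RHS]mxE.
  apply: partial_near; apply: filterS (near_dom Ux) => y Uy.
  exact: conn_mx_torsionfree.
by move=> i' k' m'; exact: conn_mx_torsionfree.
Qed.

Lemma curv_mx_skew x i j : U x ->
  curv_mx i j x *m g x + (curv_mx i j x *m g x)^T = 0.
Proof.
move=> Ux.
have dC i' := conn_mx_differentiable i' Ux; have dg := metric_differentiable Ux.
have D2 i' j' : partial_mx j' (partial_mx i' g) x =
   (partial_mx j' (conn_mx i') x *m g x + conn_mx i' x *m partial_mx j' g x)
   + (partial_mx j' (conn_mx i') x *m g x + conn_mx i' x *m partial_mx j' g x)^T.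
  rewrite (@partial_mx_near _ _ _ _ _ _ (fun y => conn_mx i' y *m g y +
    (conn_mx i' y *m g y)^T)).
    rewrite partial_mxD; [|exact: differentiable_mxM|exact/differentiable_mx_tr/differentiable_mxM].
    by rewrite partial_mx_tr partial_mxM.
  by apply: filterS (near_dom Ux) => y Uy; exact: conn_mx_compat.
have E : partial_mx i (partial_mx j g) x = partial_mx j (partial_mx i g) x.
  have entry i' j' a b : partial_mx i' (partial_mx j' g) x a b =
      partial i' (partial j' (fun y => g y a b)) x.
    by rewrite [LHS]mxE; congr partial; apply/funext => y; rewrite [LHS]mxE.
  apply/matrixP => a b.
  rewrite [LHS]entry.
  rewrite [RHS]entry.
  have sm := metric_on_smooth gU a b.
  exact: (smooth_on_partialC Uopen i j sm Ux).
move: E; rewrite (D2 j i) (D2 i j) (conn_mx_compat i Ux) (conn_mx_compat j Ux).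
exact: skew_of_second_partials (metric_on_sym gU Ux).
Qed.

Lemma riemann_algebraic_curvature x : U x -> algebraic_curvature (riemann g x).
Proof.
move=> Ux; split=> i j k l.
- by rewrite !riemannE // curv_mx_anti mulNmx mxE.
- rewrite !riemannE //.
  have := congr1 (fun M : 'M[R]_n => M k l) (curv_mx_skew i j Ux).
  rewrite [LHS]mxE [X in _ + X]mxE [RHS]mxE => /eqP.
  by rewrite addr_eq0 => /eqP.
- rewrite !riemannE //.
  have E (A B C : 'M[R]_n) : (forall m, A l m + B i m + C j m = 0) ->
     (A *m g x) l k + (B *m g x) i k + (C *m g x) j k = 0.
    move=> ABC; rewrite !mxE -!big_split big1 // => m _ /=.
    by rewrite -!mulrDl ABC mul0r.
  by apply: E => m; exact: curv_mx_bianchi.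
Qed.

End Connection.

(** * Naturality of the curvature tensor *)

(** The curvature is conjugated by a gauge transformation. The letters stand for the
    connection matrices C and w, the transformation J, their derivatives in the directions
    i and j, and the second derivative K of J; the hypotheses are the gauge law and its
    derivatives. *)
Lemma gauge_curvature (R : realType) (n : nat)
    (Ci Cj J wi wj Jj Ji DjCi DiCj Djwi Diwj K : 'M[R]_n) :
  Ci *m J = J *m wi + Ji -> Cj *m J = J *m wj + Jj ->
  DjCi *m J + Ci *m Jj = (Jj *m wi + J *m Djwi) + K ->
  DiCj *m J + Cj *m Ji = (Ji *m wj + J *m Diwj) + K ->
  (DiCj - DjCi + Cj *m Ci - Ci *m Cj) *m J =
  J *m (Diwj - Djwi + wj *m wi - wi *m wj).
Proof.
move=> ei ej.
have -> : Ji = Ci *m J - J *m wi by rewrite ei addrAC subrr add0r.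
have -> : Jj = Cj *m J - J *m wj by rewrite ej addrAC subrr add0r.
move=> {ei ej} /(canRL (addrK _)) E1 /(canRL (addrK _)) E2.
rewrite !(mulmxBl, mulmxDl, mulmxBr, mulmxDr) E1 E2 !(mulmxBl, mulmxBr) !mulmxA.
move: (Ci *m J *m wj) (Cj *m J *m wi) (J *m wi *m wj) (J *m wj *m wi)
  (J *m Diwj) (J *m Djwi) (Cj *m Ci *m J) (Ci *m Cj *m J) => a b c d e f g h.
by apply/matrixP => k l; rewrite !mxE; ring.
Qed.

Lemma sandwich_mxE (R : realType) (n p : nat) (A B : 'M[R]_(n, p)) (M : 'M[R]_p) l k :
  (A *m M *m B^T) l k = \sum_c \sum_d B k c * A l d * M d c.
Proof.
rewrite mxE; apply: eq_bigr => c _; rewrite !mxE mulr_suml.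
by apply: eq_bigr => d _; ring.
Qed.

Section Pullback.
Variables (R : realType) (n : nat) (U V : set 'rV[R]_n).
Variables (h g : 'rV[R]_n -> 'M[R]_n) (phi : 'rV[R]_n -> 'rV[R]_n).
Hypotheses (Uopen : open U) (Vopen : open V).
Hypotheses (hU : metric_on U h) (gV : metric_on V g).
Hypothesis phi_smooth : forall a, smooth_on U (fun y => phi y 0 a).
Hypothesis phiUV : forall y, U y -> V (phi y).
Hypothesis h_pullback : forall y, U y ->
  h y = jacobian phi y *m g (phi y) *m (jacobian phi y)^T.
Implicit Types (x y : 'rV[R]_n).

(** Equal to the Jacobian on U, but given by partial derivatives, which can be
    differentiated again. *)
Definition jac_mx y : 'M[R]_n := \matrix_(i, a) partial i (fun z => phi z 0 a) y.

Lemma phi_differentiable y a : U y -> differentiable (fun z => phi z 0 a) y.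
Proof. by move=> Uy; apply: (smooth_on_differentiable Uopen _ Uy); exact: phi_smooth. Qed.

Lemma jac_jacobian y : U y -> jacobian phi y = jac_mx y.
Proof.
move=> Uy; apply/matrixP => i a; rewrite [RHS]mxE jacobianE // => b.
exact: phi_differentiable.
Qed.

Lemma jac_differentiable y : U y -> differentiable_mx jac_mx y.
Proof.
move=> Uy i a; under eq_fun do rewrite mxE.
by apply: (smooth_on_differentiable Uopen _ Uy); apply: smooth_on_partial;
  exact: phi_smooth.
Qed.

Lemma partial_jac_differentiable i y : U y -> differentiable_mx (partial_mx i jac_mx) y.
Proof.
move=> Uy k a; under eq_fun do rewrite mxE.
have -> : partial i (fun z => jac_mx z k a) = partial i (partial k (fun z => phi z 0 a)).
  by congr partial; apply/funext => z; rewrite mxE.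
apply: (smooth_on_differentiable Uopen _ Uy); do 2![apply: smooth_on_partial].
exact: phi_smooth.
Qed.

Lemma pullback_jac y : U y -> h y = jac_mx y *m g (phi y) *m (jac_mx y)^T.
Proof. by move=> Uy; rewrite h_pullback // jac_jacobian. Qed.

Lemma jac_unit y : U y -> jac_mx y \in unitmx.
Proof.
move=> Uy; have := metric_on_unit hU Uy.
by rewrite pullback_jac // -mulmxA unitmx_mul => /andP[].
Qed.

Lemma partial_jac_sym i k y c : U y -> partial_mx i jac_mx y k c =
  partial_mx k jac_mx y i c.
Proof.
move=> Uy.
have entry i' k' : partial_mx i' jac_mx y k' c = partial i' (partial k' (fun z =>
  phi z 0 c)) y.
  by rewrite [LHS]mxE; congr partial; apply/funext => z; rewrite mxE.
rewrite [LHS]entry [RHS]entry; have sm := phi_smooth c.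
exact: (smooth_on_partialC Uopen i k sm Uy).
Qed.

Lemma partial_mx_comp p q (A : 'rV[R]_n -> 'M[R]_(p, q)) i y : U y ->
  differentiable_mx A (phi y) ->
  partial_mx i (fun z => A (phi z)) y = \sum_a jac_mx y i a *: partial_mx a A (phi y).
Proof.
move=> Uy dA; apply/matrixP => k l; rewrite [LHS]mxE summxE.
have dphi a := phi_differentiable a Uy.
rewrite (partial_comp dphi i (dA k l)); apply: eq_bigr => a _.
by rewrite jac_jacobian // [RHS]mxE; congr (_ * _); rewrite [RHS]mxE.
Qed.

(** The pullback under phi of the connection of g, in the frame of g. *)
Definition pulled_conn i y : 'M[R]_n := \sum_a jac_mx y i a *: conn_mx g a (phi y).

Lemma pulled_conn_differentiable i y : U y -> differentiable_mx (pulled_conn i) y.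
Proof.
move=> Uy k m.
have -> : (fun z => pulled_conn i z k m) =
    (fun z => \sum_a jac_mx z i a * conn_mx g a (phi z) k m).
  by apply/funext => z; rewrite summxE; apply: eq_bigr => a _; rewrite [LHS]mxE.
apply: differentiable_fsum => a; apply: differentiableM; first exact: jac_differentiable.
apply: (@differentiable_fcomp _ _ _ phi y (fun b => phi_differentiable b Uy)
  (fun z => conn_mx g a z k m)).
exact: (conn_mx_differentiable Vopen gV a (phiUV Uy)).
Qed.

(** The transformation law of the Christoffel symbols. Its right hand side defines a connection
    which preserves h, because h is the pullback of g, and which is torsion-free, because
    second derivatives of phi are symmetric; so [conn_mx_unique] applies. *)
Lemma conn_mx_pullback i y : U y ->
  conn_mx h i y *m jac_mx y = jac_mx y *m pulled_conn i y + partial_mx i jac_mx y.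
Proof.
move=> Uy; have uJ := jac_unit Uy; have Vy := phiUV Uy.
pose B i := jac_mx y *m pulled_conn i y + partial_mx i jac_mx y.
(* The connection that the gauge law predicts for h; Koszul identifies it. *)
pose A i := B i *m invmx (jac_mx y).
suff E : A i = conn_mx h i y by rewrite -E /A mulmxKV.
have dg := metric_differentiable Vopen gV Vy; have dJ := jac_differentiable Uy.
have dG : differentiable_mx (fun z => g (phi z)) y.
  move=> k l; exact: (@differentiable_fcomp _ _ _ phi y (fun b => phi_differentiable b Uy)
    (fun z => g z k l)).
have DG i' : partial_mx i' (fun z => g (phi z)) y =
    pulled_conn i' y *m g (phi y) + (pulled_conn i' y *m g (phi y))^T.
  rewrite partial_mx_comp // /pulled_conn mulmx_suml linear_sum -big_split.
  apply: eq_bigr => a _ /=.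
  by rewrite (conn_mx_compat Vopen gV a Vy) -scalemxAl linearZ scalerDr.
apply: (conn_mx_unique (A := A) hU Uy) => [i'|i' k m].
- have -> : A i' *m h y = B i' *m g (phi y) *m (jac_mx y)^T.
    by rewrite pullback_jac // /A -(mulmxA (jac_mx y)) -mulmxA mulKmx // mulmxA.
  rewrite (@partial_mx_near _ _ _ _ _ _ (fun z =>
    jac_mx z *m g (phi z) *m (jac_mx z)^T)); last first.
    by apply: filterS (near_dom Uopen Uy) => z Uz; exact: pullback_jac.
  have dJG : differentiable_mx (fun z => jac_mx z *m g (phi z)) y by exact:
    differentiable_mxM.
  have dJt : differentiable_mx (fun z => (jac_mx z)^T) y by exact: differentiable_mx_tr.
  rewrite (partial_mxM i' dJG dJt) (partial_mxM i' dJ dG) partial_mx_tr DG /B.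
  move: (pulled_conn i' y) (partial_mx i' jac_mx y) (jac_mx y) (metric_on_sym gV Vy).
  move: (g (phi y)) => G w D J sG.
  rewrite !mulmxDl !mulmxDr !mulmxDl !linearD /= !trmx_mul !trmxK !sG !mulmxA.
  move: (D *m G *m J^T) (J *m w *m G *m J^T) (J *m G *m w^T *m J^T) (J *m G *m D^T).
  by move=> a b c d; apply/matrixP => k l; rewrite !mxE; ring.
- rewrite [LHS]mxE [RHS]mxE; apply: eq_bigr => c _; congr (_ * _).
  have addE (M N : 'M[R]_n) p q : (M + N) p q = M p q + N p q by rewrite mxE.
  rewrite /B [LHS]addE [RHS]addE; congr (_ + _); last exact: partial_jac_sym.
  rewrite [LHS]mxE [RHS]mxE.
  transitivity (\sum_b \sum_a jac_mx y k b * jac_mx y i' a * conn_mx g a (phi y) b c).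
    apply: eq_bigr => b _; rewrite summxE mulr_sumr; apply: eq_bigr => a _.
    by rewrite [X in _ * X = _]mxE mulrA.
  rewrite exchange_big; apply: eq_bigr => a _; rewrite summxE mulr_sumr.
  apply: eq_bigr => b _; rewrite [X in _ = _ * X]mxE mulrCA mulrA.
  by congr (_ * _); exact: (conn_mx_torsionfree Vopen gV).
Qed.

(** The curvature of [pulled_conn], which [pulled_curvE] shows to be the pullback of the
    curvature of g. *)
Definition pulled_curv i j y : 'M[R]_n :=
  partial_mx i (pulled_conn j) y - partial_mx j (pulled_conn i) y
  + pulled_conn j y *m pulled_conn i y - pulled_conn i y *m pulled_conn j y.

Lemma curv_mx_gauge i j y : U y ->
  curv_mx h i j y *m jac_mx y = jac_mx y *m pulled_curv i j y.
Proof.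
move=> Uy.
have dJ := jac_differentiable Uy.
have der i' j' : partial_mx j' (conn_mx h i') y *m jac_mx y +
  conn_mx h i' y *m partial_mx j' jac_mx y =
    (partial_mx j' jac_mx y *m pulled_conn i' y +
      jac_mx y *m partial_mx j' (pulled_conn i') y)
    + partial_mx j' (partial_mx i' jac_mx) y.
  have dC := conn_mx_differentiable Uopen hU i' Uy.
  have dw := pulled_conn_differentiable i' Uy.
  rewrite -(partial_mxM j' dC dJ) -(partial_mxM j' dJ dw) -partial_mxD; first last.
  - exact: partial_jac_differentiable.
  - exact: differentiable_mxM.
  by apply: partial_mx_near; apply: filterS (near_dom Uopen Uy) => z;
    exact: conn_mx_pullback.
(* Third derivatives of phi: Schwarz for the partial derivatives of phi. *)
have K : partial_mx j (partial_mx i jac_mx) y = partial_mx i (partial_mx j jac_mx) y.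
  apply/matrixP => k c.
  have entry i' j' : partial_mx j' (partial_mx i' jac_mx) y k c =
      partial j' (partial i' (partial k (fun z => phi z 0 c))) y.
    rewrite [LHS]mxE; congr partial; apply/funext => z.
    by rewrite [LHS]mxE; congr partial; apply/funext => z'; rewrite [LHS]mxE.
  rewrite [LHS]entry [RHS]entry.
  have sm := smooth_on_partial k (phi_smooth c).
  exact: (smooth_on_partialC Uopen j i sm Uy).
apply: (gauge_curvature (conn_mx_pullback i Uy) (conn_mx_pullback j Uy) (der i j)).
by rewrite K; exact: der.
Qed.

Lemma pulled_curvE i j y : U y ->
  pulled_curv i j y =
  \sum_a \sum_b (jac_mx y i a * jac_mx y j b) *: curv_mx g a b (phi y).
Proof.
move=> Uy.
have Vy := phiUV Uy.
have dw i' j' : partial_mx i' (pulled_conn j') y =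
   \sum_b partial_mx i' jac_mx y j' b *: conn_mx g b (phi y)
   + \sum_b \sum_a (jac_mx y i' a * jac_mx y j' b) *: partial_mx a (conn_mx g b) (phi y).
  apply/matrixP => k m; rewrite [LHS]mxE.
  have -> : (fun z => pulled_conn j' z k m) =
      (fun z => \sum_a jac_mx z j' a * conn_mx g a (phi z) k m).
    by apply/funext => z; rewrite summxE; apply: eq_bigr => a _; rewrite [LHS]mxE.
  have dc b : differentiable (fun z => conn_mx g b (phi z) k m) y.
    apply: (@differentiable_fcomp _ _ _ phi y (fun b => phi_differentiable b Uy)
      (fun z => conn_mx g b z k m)).
    exact: (conn_mx_differentiable Vopen gV b Vy).
  have dj b : differentiable (fun z => jac_mx z j' b) y by exact: jac_differentiable.
  rewrite partial_sum; last by move=> b; exact: differentiableM.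
  rewrite -big_split [RHS]summxE; apply: eq_bigr => b _.
  rewrite partialM //.
  have addE (M N : 'M[R]_n) p q : (M + N) p q = M p q + N p q by rewrite mxE.
  have scE c (M : 'M[R]_n) p q : (c *: M) p q = c * M p q by rewrite mxE.
  rewrite [RHS]addE; congr (_ + _).
    by rewrite [RHS]scE [X in _ = X * _]mxE.
  rewrite summxE.
  have := partial_mx_comp i' Uy (conn_mx_differentiable Vopen gV b Vy).
  move=> /(congr1 (fun M : 'M[R]_n => M k m)); rewrite [LHS]mxE => ->.
  rewrite summxE mulr_sumr; apply: eq_bigr => a _.
  by rewrite scE [RHS]scE mulrCA mulrA.
have ww i' j' : pulled_conn j' y *m pulled_conn i' y =
   \sum_a \sum_b (jac_mx y i' a * jac_mx y j' b) *: (conn_mx g b (phi y) *m conn_mx g a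
     (phi y)).
  rewrite mulmx_sumr; apply: eq_bigr => a _; rewrite mulmx_suml.
  by apply: eq_bigr => b _; rewrite -scalemxAl -scalemxAr scalerA mulrC.
rewrite /pulled_curv !dw !ww.
have -> : \sum_b partial_mx j jac_mx y i b *: conn_mx g b (phi y) =
          \sum_b partial_mx i jac_mx y j b *: conn_mx g b (phi y).
  by apply: eq_bigr => b _; congr (_ *: _); exact: partial_jac_sym.
rewrite opprD addrACA subrr add0r.
rewrite [X in X - _ + _ - _]exchange_big [X in _ - _ + _ - X]exchange_big /=.
rewrite -sumrB -big_split -sumrB; apply: eq_bigr => a _.
rewrite -sumrB -big_split -sumrB; apply: eq_bigr => b _ /=.
by rewrite (mulrC (jac_mx y j b)) -scalerBr -scalerDr -scalerBr.
Qed.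

(** Theorema egregium, in the form used here: the curvature tensor is natural under local
    isometries. *)
Lemma riemann_pullback y i j k l : U y ->
  riemann h y i j k l = tensor_in_frame (riemann g (phi y)) (jacobian phi y) i j k l.
Proof.
move=> Uy; rewrite jac_jacobian // (riemannE hU) // pullback_jac //.
rewrite !mulmxA curv_mx_gauge // pulled_curvE // /tensor_in_frame.
rewrite mulmx_sumr !mulmx_suml summxE; apply: eq_bigr => a _.
rewrite mulmx_sumr !mulmx_suml summxE; apply: eq_bigr => b _.
rewrite -scalemxAr -!scalemxAl.
transitivity (jac_mx y i a * jac_mx y j b *
   \sum_c \sum_d jac_mx y k c * jac_mx y l d * (curv_mx g a b (phi y) *m g (phi y)) d c).
  by rewrite [LHS]mxE; congr (_ * _); rewrite -sandwich_mxE !mulmxA.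
rewrite mulr_sumr; apply: eq_bigr => c _; rewrite mulr_sumr; apply: eq_bigr => d _.
by rewrite (riemannE gV _ _ _ _ (phiUV Uy)) !mulrA.
Qed.

End Pullback.

(** * The metric of a Riemannian product *)

Section LinearPrecomposition.
Variables (R : realType) (m n : nat) (L : {linear 'rV[R]_m -> 'rV[R]_n}).
Implicit Types (f : 'rV[R]_n -> R) (x v : 'rV[R]_m).

Lemma linear_growth_rate f v x :
  (fun t : R => t^-1 *: (f (L (t *: v + x)) - f (L x))) =
  (fun t : R => t^-1 *: (f (t *: L v + L x) - f (L x))).
Proof. by apply/funext => t; rewrite linearP. Qed.

Lemma derive_linear_comp f v x : 'D_v (fun y => f (L y)) x = 'D_(L v) f (L x).
Proof. by rewrite /derive /= linear_growth_rate. Qed.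

Lemma derivable_linear_comp f v x :
  derivable f (L x) (L v) -> derivable (fun y => f (L y)) x v.
Proof. by rewrite /derivable /= linear_growth_rate. Qed.

Hypothesis Lcont : continuous L.
Hypothesis Lbasis : forall i, L (delta_mx 0 i) = 0 \/ exists k, L (delta_mx 0 i) =
  delta_mx 0 k.

(** A coordinate projection sends basis vectors to basis vectors or to 0, so an iterated
    partial derivative of f \o L is again of this form or vanishes. *)
Lemma iterated_partial_linear_comp f (s : seq 'I_m) :
  foldr (@partial R m) (fun y => f (L y)) s = cst 0 \/
  exists t, foldr (@partial R m) (fun y => f (L y)) s =
            (fun y => foldr (@partial R n) f t (L y)).
Proof.
elim: s => [|i s [IH|[t IH]]] /=; first by right; exists [::].
  by left; apply/funext => y; rewrite IH /partial derive_cst.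
have [Li|[k Li]] := Lbasis i.
  by left; apply/funext => y; rewrite IH /partial derive_linear_comp Li derive0.
by right; exists (k :: t); apply/funext => y; rewrite IH /partial derive_linear_comp Li.
Qed.

Lemma smooth_on_linear_comp (U : set 'rV[R]_n) f :
  smooth_on U f -> smooth_on (L @^-1` U) (fun y => f (L y)).
Proof.
move=> fs s x Ux /=.
have [->|[t ->]] := iterated_partial_linear_comp f s.
  by split=> [|i]; [exact: cst_continuous|exact: derivable_cst].
have [ct dt] := fs t (L x) Ux; split=> [|i].
  by apply: continuous_comp; [exact: Lcont|exact: ct].
apply: derivable_linear_comp; have [->|[k ->]] := Lbasis i; last exact: dt.
exact: derivable0.
Qed.

End LinearPrecomposition.

Lemma smooth_on_cst (R : realType) (n : nat) (U : set 'rV[R]_n) (c : R) :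
  smooth_on U (cst c).
Proof.
move=> s x _ /=.
suff [d ->] : exists d, foldr (@partial R n) (cst c) s = cst d.
  by split=> [|i]; [exact: cst_continuous|exact: derivable_cst].
elim: s => [|i s [d IH]] /=; first by exists c.
by exists 0; apply/funext => y; rewrite IH /partial derive_cst.
Qed.

Section BlockMetric.
Variables (R : realType) (n1 n2 : nat).
Notation lsub := (lsubmx : 'rV[R]_(n1 + n2) -> 'rV[R]_n1).
Notation rsub := (rsubmx : 'rV[R]_(n1 + n2) -> 'rV[R]_n2).

Lemma lsubmx_delta_lshift (i : 'I_n1) : lsub (delta_mx 0 (lshift n2 i)) = delta_mx 0 i.
Proof. by apply/rowP => j; rewrite !mxE (inj_eq (@lshift_inj _ _)). Qed.

Lemma lsubmx_delta_rshift (i : 'I_n2) : lsub (delta_mx 0 (rshift n1 i)) = 0.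
Proof. by apply/rowP => j; rewrite !mxE eq_lrshift. Qed.

Lemma rsubmx_delta_lshift (i : 'I_n1) : rsub (delta_mx 0 (lshift n2 i)) = 0.
Proof. by apply/rowP => j; rewrite !mxE eq_rlshift. Qed.

Lemma rsubmx_delta_rshift (i : 'I_n2) : rsub (delta_mx 0 (rshift n1 i)) = delta_mx 0 i.
Proof. by apply/rowP => j; rewrite !mxE (inj_eq (@rshift_inj _ _)). Qed.

Lemma partial_lsub_lshift f x i :
  partial (lshift n2 i) (fun y => f (lsub y)) x = partial i f (lsub x).
Proof. by rewrite /partial derive_linear_comp /= lsubmx_delta_lshift. Qed.

Lemma partial_lsub_rshift f x i : partial (rshift n1 i) (fun y => f (lsub y)) x = 0.
Proof. by rewrite /partial derive_linear_comp /= lsubmx_delta_rshift derive0. Qed.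

Lemma partial_rsub_lshift f x i : partial (lshift n2 i) (fun y => f (rsub y)) x = 0.
Proof. by rewrite /partial derive_linear_comp /= rsubmx_delta_lshift derive0. Qed.

Lemma partial_rsub_rshift f x i :
  partial (rshift n1 i) (fun y => f (rsub y)) x = partial i f (rsub x).
Proof. by rewrite /partial derive_linear_comp /= rsubmx_delta_rshift. Qed.

Definition block_diag (A : 'rV[R]_n1 -> 'M[R]_n1) (B : 'rV[R]_n2 -> 'M[R]_n2)
  (x : 'rV[R]_(n1 + n2)) : 'M[R]_(n1 + n2) :=
  block_mx (A (lsub x)) 0 0 (B (rsub x)).

Section Entries.
Variables (A : 'rV[R]_n1 -> 'M[R]_n1) (B : 'rV[R]_n2 -> 'M[R]_n2).

Lemma block_diag_ul a b : (fun y => block_diag A B y (lshift n2 a) (lshift n2 b))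
  = (fun y => A (lsub y) a b).
Proof. by apply/funext => y; rewrite /block_diag block_mxEul. Qed.

Lemma block_diag_ur a b : (fun y => block_diag A B y (lshift n2 a) (rshift n1 b))
  = cst 0.
Proof. by apply/funext => y; rewrite /block_diag block_mxEur mxE. Qed.

Lemma block_diag_dl a b : (fun y => block_diag A B y (rshift n1 a) (lshift n2 b))
  = cst 0.
Proof. by apply/funext => y; rewrite /block_diag block_mxEdl mxE. Qed.

Lemma block_diag_dr a b : (fun y => block_diag A B y (rshift n1 a) (rshift n1 b))
  = (fun y => B (rsub y) a b).
Proof. by apply/funext => y; rewrite /block_diag block_mxEdr. Qed.

Lemma partial_mx_block_diag_l i x :
  partial_mx (lshift n2 i) (block_diag A B) x = block_mx (partial_mx i A (lsub x)) 0 0 0.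
Proof.
apply/matrixP => a b; rewrite [LHS]mxE.
case: (split_ordP a) => a' ->; case: (split_ordP b) => b' ->.
- by rewrite block_diag_ul block_mxEul mxE (partial_lsub_lshift (fun z => A z a' b')).
- by rewrite block_diag_ur block_mxEur mxE /partial derive_cst.
- by rewrite block_diag_dl block_mxEdl mxE /partial derive_cst.
- by rewrite block_diag_dr block_mxEdr mxE (partial_rsub_lshift (fun z => B z a' b')).
Qed.

Lemma partial_mx_block_diag_r i x :
  partial_mx (rshift n1 i) (block_diag A B) x = block_mx 0 0 0 (partial_mx i B (rsub x)).
Proof.
apply/matrixP => a b; rewrite [LHS]mxE.
case: (split_ordP a) => a' ->; case: (split_ordP b) => b' ->.
- by rewrite block_diag_ul block_mxEul mxE (partial_lsub_rshift (fun z => A z a' b')).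
- by rewrite block_diag_ur block_mxEur mxE /partial derive_cst.
- by rewrite block_diag_dl block_mxEdl mxE /partial derive_cst.
- by rewrite block_diag_dr block_mxEdr mxE (partial_rsub_rshift (fun z => B z a' b')).
Qed.

End Entries.

Variables (U1 : set 'rV[R]_n1) (U2 : set 'rV[R]_n2).
Variables (g1 : 'rV[R]_n1 -> 'M[R]_n1) (g2 : 'rV[R]_n2 -> 'M[R]_n2).
Hypotheses (U1open : open U1) (U2open : open U2).
Hypotheses (g1U : metric_on U1 g1) (g2U : metric_on U2 g2).

Definition prod_dom : set 'rV[R]_(n1 + n2) := [set x | U1 (lsub x) /\ U2 (rsub x)].

Lemma lsub_continuous : continuous lsub.
Proof. by move=> x; exact/differentiable_continuous/differentiable_lsubmx. Qed.

Lemma rsub_continuous : continuous rsub.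
Proof. by move=> x; exact/differentiable_continuous/differentiable_rsubmx. Qed.

Lemma prod_dom_open : open prod_dom.
Proof.
apply: openI; apply: open_comp => // x _; [exact: lsub_continuous|exact: rsub_continuous].
Qed.

Lemma smooth_on_sub (U V : set 'rV[R]_(n1 + n2)) f :
  V `<=` U -> smooth_on U f -> smooth_on V f.
Proof. by move=> VU fs s x /VU; exact: fs. Qed.

Lemma block_metric_on : metric_on prod_dom (block_diag g1 g2).
Proof.
split=> [a b|x [x1 x2]|x [x1 x2]].
- case: (split_ordP a) => a' ->; case: (split_ordP b) => b' ->.
  + rewrite block_diag_ul.
    apply: (smooth_on_sub (U := lsub @^-1` U1)); first by move=> x [].
    apply: (smooth_on_linear_comp _ _ (metric_on_smooth g1U a' b')).
      exact: lsub_continuous.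
    move=> i; case: (split_ordP i) => i' ->; [right; exists i'|left].
      exact: lsubmx_delta_lshift.
    exact: lsubmx_delta_rshift.
  + by rewrite block_diag_ur; exact: smooth_on_cst.
  + by rewrite block_diag_dl; exact: smooth_on_cst.
  + rewrite block_diag_dr.
    apply: (smooth_on_sub (U := rsub @^-1` U2)); first by move=> x [].
    apply: (smooth_on_linear_comp _ _ (metric_on_smooth g2U a' b')).
      exact: rsub_continuous.
    move=> i; case: (split_ordP i) => i' ->; [left|right; exists i'].
      exact: rsubmx_delta_lshift.
    exact: rsubmx_delta_rshift.
- by rewrite /block_diag tr_block_mx !trmx0 (metric_on_sym g1U x1) (metric_on_sym g2U x2).
- by rewrite unitmxE det_ublock unitrM -!unitmxE (metric_on_unit g1U x1) (metric_on_unit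
  g2U x2).
Qed.

Definition block_conn (i : 'I_(n1 + n2)) x : 'M[R]_(n1 + n2) :=
  match fintype.split i with
  | inl i1 => block_diag (conn_mx g1 i1) (fun=> 0) x
  | inr i2 => block_diag (fun=> 0) (conn_mx g2 i2) x
  end.

Lemma block_conn_l i : block_conn (lshift n2 i) = block_diag (conn_mx g1 i) (fun=> 0).
Proof. by apply/funext => x; rewrite /block_conn (unsplitK (inl i)). Qed.

Lemma block_conn_r i : block_conn (rshift n1 i) = block_diag (fun=> 0) (conn_mx g2 i).
Proof. by apply/funext => x; rewrite /block_conn (unsplitK (inr i)). Qed.

(** The block matrices of the two connections form a torsion-free connection that preserves
    the block metric; [conn_mx_unique] gives the claim without any computation of Christoffel
    symbols. *)
Lemma conn_mx_block x i : prod_dom x ->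
  conn_mx (block_diag g1 g2) i x = block_conn i x.
Proof.
move=> Ux; have [x1 x2] := Ux; apply/esym.
apply: (conn_mx_unique (A := block_conn ^~ x) block_metric_on Ux) => [j|j k m].
- case: (split_ordP j) => j' ->.
  + rewrite block_conn_l partial_mx_block_diag_l (conn_mx_compat U1open g1U _ x1)
    /block_diag.
    rewrite mulmx_block !(mulmx0, mul0mx, addr0) tr_block_mx !trmx0.
    by rewrite add_block_mx !addr0.
  + rewrite block_conn_r partial_mx_block_diag_r (conn_mx_compat U2open g2U _ x2)
    /block_diag.
    rewrite mulmx_block !(mulmx0, mul0mx, add0r) tr_block_mx !trmx0.
    by rewrite add_block_mx !addr0.
- case: (split_ordP j) => j' ->; case: (split_ordP k) => k' ->;
  case: (split_ordP m) => m' ->;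
  rewrite ?block_conn_l ?block_conn_r /block_diag
    ?block_mxEul ?block_mxEur ?block_mxEdl ?block_mxEdr ?[(0 : 'M[R]__) _ _]mxE //.
  + exact: (conn_mx_torsionfree U1open g1U).
  + exact: (conn_mx_torsionfree U2open g2U).
Qed.

Lemma riemann_block_split x : prod_dom x -> split_tensor (riemann (block_diag g1 g2) x).
Proof.
move=> Ux i j k l; rewrite (riemannE block_metric_on) //.
have pC i' j' : partial_mx i' (conn_mx (block_diag g1 g2) j') x =
  partial_mx i' (block_conn j') x.
  apply: partial_mx_near; apply: filterS (near_dom prod_dom_open Ux) => y.
  exact: conn_mx_block.
have partial_mx0 p q (i' : 'I_p) (y : 'rV[R]_p) : partial_mx i' (fun=> 0 : 'M[R]_q) y = 0.
  apply/matrixP => a b; rewrite [LHS]mxE [RHS]mxE.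
  have -> : (fun=> (0 : 'M[R]_q) a b) = (cst 0 : 'rV[R]_p -> R).
    by apply/funext => z; rewrite mxE.
  exact: derive_cst.
have blockM A B C D : block_mx A 0 0 B *m block_mx C 0 0 D = block_mx (A *m C) 0 0 (B *m D)
    :> 'M[R]_(n1 + n2).
  by rewrite mulmx_block !(mulmx0, mul0mx, addr0, add0r).
have blockB A B C D : block_mx A 0 0 B - block_mx C 0 0 D = block_mx (A - C) 0 0 (B - D)
    :> 'M[R]_(n1 + n2).
  by rewrite opp_block_mx add_block_mx !oppr0 !addr0.
have blockD A B C D : block_mx A 0 0 B + block_mx C 0 0 D = block_mx (A + C) 0 0 (B + D)
    :> 'M[R]_(n1 + n2).
  by rewrite add_block_mx !addr0.
rewrite /curv_mx !pC !conn_mx_block //.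
case: (split_ordP i) => i' ->; case: (split_ordP j) => j' ->;
  rewrite ?block_conn_l ?block_conn_r ?partial_mx_block_diag_l ?partial_mx_block_diag_r
    ?partial_mx0 /block_diag
    !blockM !blockB !blockD !blockB !blockM !(mulmx0, mul0mx, addr0, add0r, subr0, oppr0);
  case: (split_ordP k) => k' ->; case: (split_ordP l) => l' ->;
  rewrite ?in_first_lshift ?in_first_rshift ?block_mxEul ?block_mxEur ?block_mxEdl
    ?block_mxEdr //= => _; by rewrite mxE.
Qed.

End BlockMetric.

(** * Frames *)

Section TensorInFrame.
Variables (R : realType) (n : nat).
Notation tensor4 := ('I_n -> 'I_n -> 'I_n -> 'I_n -> R).
Notation quad := (('I_n * 'I_n) * ('I_n * 'I_n))%type.
Implicit Types (T : tensor4) (E A B : 'M[R]_n).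

Lemma sum_quad (F : tensor4) :
  \sum_i \sum_j \sum_k \sum_l F i j k l =
  \sum_(x : quad) F x.1.1 x.1.2 x.2.1 x.2.2.
Proof.
under eq_bigr => i _ do under eq_bigr => j _ do rewrite pair_bigA.
rewrite pair_bigA pair_bigA /=; by apply: eq_bigr => -[[i j] [k l]].
Qed.

Lemma prod4_sum (f g h m : 'I_n -> R) :
  (\sum_i f i) * (\sum_j g j) * (\sum_k h k) * (\sum_l m l) =
  \sum_(x : quad) f x.1.1 * g x.1.2 * h x.2.1 * m x.2.2.
Proof.
rewrite -(sum_quad (fun i j k l => f i * g j * h k * m l)).
rewrite -!mulrA mulr_suml; apply: eq_bigr => i _.
rewrite mulr_suml mulr_sumr; apply: eq_bigr => j _.
rewrite mulr_suml !mulr_sumr; apply: eq_bigr => k _.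
by rewrite !mulr_sumr; apply: eq_bigr => l _; rewrite !mulrA.
Qed.

Lemma tensor_in_frameE T E a b c d : tensor_in_frame T E a b c d =
  \sum_(x : quad) E a x.1.1 * E b x.1.2 * E c x.2.1 * E d x.2.2
    * T x.1.1 x.1.2 x.2.1 x.2.2.
Proof. exact: (sum_quad (fun i j k l => E a i * E b j * E c k * E d l * T i j k l)). Qed.

Lemma tensor_in_frame_comp T A B :
  tensor_in_frame (tensor_in_frame T A) B = tensor_in_frame T (B *m A).
Proof.
apply/funext => a; apply/funext => b; apply/funext => c; apply/funext => d.
rewrite !tensor_in_frameE.
under eq_bigr do rewrite tensor_in_frameE mulr_sumr.
rewrite exchange_big; apply: eq_bigr => y _ /=.
rewrite [in RHS]mxE [(B *m A) b _]mxE [(B *m A) c _]mxE [(B *m A) d _]mxE.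
rewrite prod4_sum mulr_suml; apply: eq_bigr => x _; ring.
Qed.

Lemma tensor_in_frame1 T : tensor_in_frame T 1%:M = T.
Proof.
apply/funext => a; apply/funext => b; apply/funext => c; apply/funext => d.
rewrite tensor_in_frameE (bigD1 ((a, b), (c, d))) //= !mxE !eqxx !mul1r.
rewrite big1 ?addr0 // => -[[i j] [k l]]; rewrite !xpair_eqE /= => ne.
rewrite !mxE !(eq_sym _ i) !(eq_sym _ j) !(eq_sym _ k) !(eq_sym _ l).
by move: ne; do 4![case: eqP => _ //=]; rewrite ?(mul0r, mulr0).
Qed.

Lemma tensor_in_frame0 E a b c d : tensor_in_frame (fun _ _ _ _ => 0) E a b c d = 0.
Proof. by rewrite tensor_in_frameE big1 // => x _; rewrite mulr0. Qed.

Lemma tensor_in_frame_curv T E :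
  algebraic_curvature T -> algebraic_curvature (tensor_in_frame T E).
Proof.
move=> [a12 a34 bia]; split=> a b c d; rewrite !tensor_in_frameE.
- rewrite (reindex (fun x : quad => ((x.1.2, x.1.1), x.2))) /=; last first.
    by apply: onW_bij; exists (fun x : quad => ((x.1.2, x.1.1), x.2)) => -[[? ?] ?].
  by rewrite -sumrN; apply: eq_bigr => x _; rewrite a12; ring.
- rewrite (reindex (fun x : quad => (x.1, (x.2.2, x.2.1)))) /=; last first.
    by apply: onW_bij; exists (fun x : quad => (x.1, (x.2.2, x.2.1))) => -[? [? ?]].
  by rewrite -sumrN; apply: eq_bigr => x _; rewrite a34; ring.
- rewrite [X in _ + X + _](reindex (fun x : quad =>
  ((x.1.2, x.2.2), (x.2.1, x.1.1)))) /=; last first.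
    apply: onW_bij; exists (fun y : quad => ((y.2.2, y.1.1), (y.2.1, y.1.2))).
      by move=> [[? ?] [? ?]].
    by move=> [[? ?] [? ?]].
  rewrite [X in _ + _ + X](reindex (fun x : quad =>
    ((x.2.2, x.1.1), (x.2.1, x.1.2)))) /=; last first.
    apply: onW_bij; exists (fun y : quad => ((y.1.2, y.2.2), (y.2.1, y.1.1))).
      by move=> [[? ?] [? ?]].
    by move=> [[? ?] [? ?]].
  rewrite -!big_split big1 // => -[[i j] [k l]] _ /=.
  have := bia i j k l; set p := T i j k l; set q := T j l k i; set r := T l i k j.
  move=> pqr; have -> : p = - q - r by lra.
  ring.
Qed.

End TensorInFrame.

Lemma tensor_in_block_frame_split (R : realType) (n1 n2 : nat)
    (T : 'I_(n1 + n2) -> 'I_(n1 + n2) -> 'I_(n1 + n2) -> 'I_(n1 + n2) -> R)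
    (E1 : 'M[R]_n1) (E2 : 'M[R]_n2) :
  split_tensor T -> split_tensor (tensor_in_frame T (block_mx E1 0 0 E2)).
Proof.
move=> Ts a b c d abcd; rewrite tensor_in_frameE big1 // => -[[i j] [k l]] _ /=.
have E0 p q : in_first p != in_first q -> (block_mx E1 0 0 E2) p q = 0.
  case: (split_ordP p) => p' ->; case: (split_ordP q) => q' ->;
    by rewrite ?in_first_lshift ?in_first_rshift //= => _;
       rewrite ?block_mxEur ?block_mxEdl mxE.
have [ai|/E0 ->] := eqVneq (in_first a) (in_first i); last by rewrite !mul0r.
have [bj|/E0 ->] := eqVneq (in_first b) (in_first j); last by rewrite mulr0 !mul0r.
have [ck|/E0 ->] := eqVneq (in_first c) (in_first k); last by rewrite mulr0 !mul0r.
have [dl|/E0 ->] := eqVneq (in_first d) (in_first l); last by rewrite mulr0 mul0r.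
by rewrite Ts ?mulr0 // -ai -bj -ck -dl.
Qed.

Definition posdef (R : realType) (n : nat) (g : 'M[R]_n) :=
  forall v : 'rV[R]_n, v != 0 -> 0 < (v *m g *m v^T) 0 0.

Lemma posdef_unitmx (R : realType) (n : nat) (g : 'M[R]_n) : posdef g -> g \in unitmx.
Proof.
move=> gp; rewrite unitmxE unitfE; apply/negP => /det0P[v v0 vg].
by have := gp v v0; rewrite vg mul0mx mxE ltxx.
Qed.

(** Gram-Schmidt by induction on the dimension: the first basis vector is normalized and the
    others are made orthogonal to it. *)
Lemma exists_orthonormal_frame (R : realType) (n : nat) (g : 'M[R]_n) :
  g^T = g -> posdef g -> exists E : 'M[R]_n, E *m g *m E^T = 1%:M.
Proof.
elim: n g => [|n IH]; first by move=> g _ _; exists 1%:M; apply/matrixP => -[].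
rewrite -add1n => g sg gp.
pose a := g 0 0.
pose b : 'rV[R]_n := ursubmx g.
pose d : 'M[R]_n := drsubmx g.
have gE : g = block_mx a%:M b b^T d.
  rewrite -[LHS](submxK g); congr block_mx.
    by rewrite [LHS]mx11_scalar !mxE; congr (_ _ _)%:M; apply: val_inj.
  by rewrite /b trmx_ursub sg.
have a0 : 0 < a.
  have := gp (delta_mx 0 0); rewrite trmx_delta -rowE -colE !mxE; apply.
  apply/eqP => /matrixP /(_ 0 0); rewrite !mxE /= => /eqP; by rewrite oner_eq0.
pose r := (Num.sqrt a)^-1.
have r0 : r * a * r = 1.
  by rewrite mulrAC -expr2 exprVn sqr_sqrtr ?(ltW a0) // mulVf // gt_eqF.
(* One step of the Gram-Schmidt process: S is the Schur complement of a. *)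
pose L : 'M[R]_(1 + n) := block_mx r%:M 0 (- a^-1 *: b^T) 1%:M.
pose S := d - a^-1 *: (b^T *m b).
have LgL : L *m g *m L^T = block_mx 1%:M 0 0 S.
  rewrite gE /L tr_block_mx !mulmx_block !trmx0 !tr_scalar_mx.
  rewrite !(mulmx0, mul0mx, addr0, mul1mx, mulmx1).
  have -> : - a^-1 *: b^T *m a%:M = - b^T.
    by rewrite mul_mx_scalar scalerA mulrN mulfV ?gt_eqF // scaleN1r.
  rewrite addNr !mul0mx add0r -!scalar_mxM r0; congr block_mx.
    rewrite linearZ /= trmxK mul_scalar_mx scalerA mul_scalar_mx -scalerDl.
    by rewrite mulrN mulfK ?gt_eqF // addNr scale0r.
  by rewrite -scalemxAl scaleNr addrC.
have sS : S^T = S.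
  by rewrite /S linearB linearZ /= trmx_mul trmxK /d trmx_drsub sg.
have pS : posdef S.
  move=> v v0; pose w : 'rV[R]_(1 + n) := row_mx 0 v.
  have wL : w *m L = row_mx (v *m (- a^-1 *: b^T)) v.
    by rewrite mul_row_block !mul0mx !add0r mulmx1.
  have <- : w *m L *m g *m (w *m L)^T = v *m S *m v^T.
    rewrite trmx_mul !mulmxA -(mulmxA w) -(mulmxA w) LgL /w.
    rewrite mul_row_block !(mulmx0, mul0mx, add0r, addr0) tr_row_mx trmx0.
    by rewrite mul_row_col mul0mx add0r.
  apply: gp; rewrite wL; apply: contraNneq v0 => e.
  by rewrite -(row_mxKr (v *m (- a^-1 *: b^T)) v) e linear0.
have [E' EE] := IH S sS pS.
exists ((block_mx 1%:M 0 0 E' : 'M[R]_(1 + n)) *m L).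
rewrite trmx_mul !mulmxA -(mulmxA _ L) -(mulmxA _ _ L^T) LgL.
rewrite tr_block_mx !trmx0 trmx1 !mulmx_block !(mulmx0, mul0mx, addr0, add0r, mulmx1).
by rewrite EE -scalar_mx_block.
Qed.

(** * Local representatives of maps between manifolds *)

(** Coordinates on an open set, described through the continuous parametrization [bwd];
    in this form the notion passes to products at once. *)
Record inverse_chart (R : realType) (n : nat) (T : topologicalType)
    (c : chart R n T) : Prop := InverseChart {
  inverse_chart_open_dom : open (dom c);
  inverse_chart_open_img : open (img c);
  inverse_chart_fwdK : forall p, dom c p -> img c (fwd c p) /\ bwd c (fwd c p) = p;
  inverse_chart_bwdK : forall x, img c x -> dom c (bwd c x) /\ fwd c (bwd c x) = x;
  inverse_chart_continuous : forall x, img c x -> {for x, continuous (bwd c)} }.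

Lemma inverse_chart_of_chart (R : realType) (n : nat) (T : topologicalType)
  (c : chart R n T) : is_chart c -> inverse_chart c.
Proof. by case. Qed.

Lemma inverse_chart_prod (R : realType) (m n : nat) (S T : topologicalType)
    (c : chart R m S) (d : chart R n T) :
  inverse_chart c -> inverse_chart d ->
  inverse_chart (prod_chart c d).
Proof.
move=> [oc ic fc bc cc] [od id_ fd bd cd]; split=> /=.
- rewrite openE => -[p q] [/= cp dq].
  by exists (dom c, dom d) => //; split; apply: open_nbhs_nbhs.
- exact: prod_dom_open.
- move=> [p q] [/= cp dq]; rewrite row_mxKl row_mxKr.
  by have [? ->] := fc _ cp; have [? ->] := fd _ dq.
- move=> x [/= cx dx]; have [? e1] := bc _ cx; have [? e2] := bd _ dx.
  by split; [split|rewrite e1 e2 hsubmxK].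
- move=> x [/= cx dx]; have h1 : {for x, continuous (bwd c \o lsubmx)}.
    by apply: continuous_comp; [exact: lsub_continuous|exact: cc].
  have h2 : {for x, continuous (bwd d \o rsubmx)}.
    by apply: continuous_comp; [exact: rsub_continuous|exact: cd].
  exact: cvg_pair h1 h2.
Qed.

Section LocalRepresentatives.
Variables (R : realType) (m n : nat).
Variables (M : riemannian_data R m) (N : riemannian_data R n).
Variables (F : M -> N) (i : chart_index M) (j : chart_index N).
Hypotheses (Fsmooth : smooth_map F).
Hypotheses (ci : inverse_chart (atlas M i)) (cj : inverse_chart (atlas N j)).

Lemma local_dom_open : open (local_dom F i j).
Proof.
rewrite openE => x [xi Fx].
have c : {for x, continuous (F \o bwd (atlas M i))}.
  apply: continuous_comp; first exact: inverse_chart_continuous ci _ xi.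
  exact: Fsmooth.1.
have n1 : nbhs x (img (atlas M i)) by apply: open_nbhs_nbhs; split=> //;
  exact: inverse_chart_open_img ci.
have n2 : nbhs x ((F \o bwd (atlas M i)) @^-1` dom (atlas N j)).
  by apply: c; apply: open_nbhs_nbhs; split=> //; exact: inverse_chart_open_dom cj.
exact: filterI n1 n2.
Qed.

Lemma local_rep_differentiable x a : local_dom F i j x ->
  differentiable (fun y => local_rep F i j y 0 a) x.
Proof.
by move=> xd; apply: (smooth_on_differentiable local_dom_open _ xd); exact: Fsmooth.2.
Qed.

Lemma local_rep_img x : local_dom F i j x -> img (atlas N j) (local_rep F i j x).
Proof. by move=> [_ /(inverse_chart_fwdK cj)[]]. Qed.

Lemma local_rep_inverse (G : N -> M) x : cancel F G -> local_dom F i j x ->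
  local_dom G j i (local_rep F i j x) /\
  local_rep G j i (local_rep F i j x) = x.
Proof.
move=> FG [xi Fx]; have [img_x e] := inverse_chart_fwdK cj Fx.
rewrite /local_dom /local_rep /= e FG; have [dx ex] := inverse_chart_bwdK ci xi.
by split.
Qed.

End LocalRepresentatives.

Section InverseDimension.
Variables (R : realType) (m n : nat).
Variables (M : riemannian_data R m) (N : riemannian_data R n).
Variables (F : M -> N) (G : N -> M) (i : chart_index M) (j : chart_index N).
Hypotheses (Fs : smooth_map F) (Gs : smooth_map G) (FG : cancel F G).
Hypotheses (ci : inverse_chart (atlas M i)) (cj : inverse_chart (atlas N j)).

Lemma jacobian_inverse x : local_dom F i j x ->
  jacobian (local_rep F i j) x *m jacobian (local_rep G j i) (local_rep F i j x) = 1%:M.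
Proof.
move=> xd; have [yd _] := local_rep_inverse ci cj FG xd.
have dF a := local_rep_differentiable Fs ci cj a xd.
have dG a := local_rep_differentiable Gs cj ci a yd.
apply/matrixP => k l; rewrite [LHS]mxE.
transitivity (partial k (fun z => local_rep G j i (local_rep F i j z) 0 l) x).
  rewrite (partial_comp dF k (dG l)); apply: eq_bigr => a _; congr (_ * _).
  by rewrite jacobianE.
rewrite (@partial_near _ _ _ (fun z => z 0 l)).
  have di : derivable (@id 'rV[R]_m) x (delta_mx 0 k) by exact: derivable_id.
  have := derive_mx di.
  by rewrite derive_id => /matrixP /(_ 0 l); rewrite !mxE eq_sym => ->.
have := local_dom_open Fs ci cj; rewrite openE => /(_ x xd).
by apply: filterS => z zd; rewrite (local_rep_inverse ci cj FG zd).2.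
Qed.

(** A smooth map with a smooth left inverse has a Jacobian with a right inverse. *)
Lemma leq_dim_of_left_inverse x : local_dom F i j x -> (m <= n)%N.
Proof. by move=> /jacobian_inverse /mulmx1_min. Qed.

End InverseDimension.

Lemma manifold_metric_on (R : realType) (n : nat) (M : riemannian_data R n) i :
  riemannian_manifold M -> metric_on (img (atlas M i)) (metric M i).
Proof.
move=> MM; split=> [a b|x xi|x xi].
- exact: (metric_smooth MM).
- exact: (Defs.metric_sym MM).
- by apply: posdef_unitmx => v v0; exact: (metric_posdef MM).
Qed.

Lemma metric_on_sub (R : realType) (n : nat) (U V : set 'rV[R]_n) g :
  V `<=` U -> metric_on U g -> metric_on V g.
Proof.
move=> VU [gs gsym gu]; split=> [a b|x /VU|x /VU]; [|exact: gsym|exact: gu].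
by move=> s x /VU; exact: gs.
Qed.

Lemma riemann_local_isometry (R : realType) (n : nat) (M N : riemannian_data R n)
    (F : M -> N) (i : chart_index M) (j : chart_index N) x :
  smooth_map F -> preserves_metric F ->
  inverse_chart (atlas M i) -> inverse_chart (atlas N j) ->
  metric_on (img (atlas M i)) (metric M i) ->
  metric_on (img (atlas N j)) (metric N j) ->
  local_dom F i j x ->
  riemann (metric M i) x =
  tensor_in_frame (riemann (metric N j) (local_rep F i j x)) (jacobian (local_rep F i j) x).
Proof.
move=> Fs Fm ci cj gM gN xd.
apply/funext => a; apply/funext => b; apply/funext => c; apply/funext => d.
apply: (riemann_pullback (local_dom_open Fs ci cj) (inverse_chart_open_img cj) _ gN) => //.
- by apply: metric_on_sub gM => y [].
- by move=> k; exact: Fs.2.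
- by move=> y; exact: local_rep_img.
- by move=> y /Fm.
Qed.

(** * Local irreducibility *)

Lemma split_k_nonneg_eq0 (R : realType) (n1 n2 : nat)
    (T : 'I_(n1 + n2) -> 'I_(n1 + n2) -> 'I_(n1 + n2) -> 'I_(n1 + n2) -> R) :
  (0 < n1)%N -> (0 < n2)%N -> algebraic_curvature T -> split_tensor T ->
  k_nonneg_second_kind (n1 + n2) T -> forall i j k l, T i j k l = 0.
Proof.
move=> n10 n20 TC Ts Tk; apply: split_psd_curv_eq0 => //.
exact: second_kind_psd.
Qed.

Section ProductCover.
Variables (R : realType) (n n1 n2 : nat).
Variables (M1 : riemannian_data R n1) (M2 : riemannian_data R n2).
Hypotheses (M1M : riemannian_manifold M1) (M2M : riemannian_manifold M2).
Let P := riemannian_product M1 M2.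

Lemma product_chart (j : chart_index P) : inverse_chart (atlas P j).
Proof.
apply: inverse_chart_prod; apply: inverse_chart_of_chart.
  exact: manifold_chart M1M j.1.
exact: manifold_chart M2M j.2.
Qed.

Lemma product_cover (p : P) : exists j, dom (atlas P j) p.
Proof.
have [j1 p1] := manifold_cover M1M p.1; have [j2 p2] := manifold_cover M2M p.2.
by exists (j1, j2).
Qed.

Lemma product_metric_on (j : chart_index P) : metric_on (img (atlas P j)) (metric P j).
Proof. by apply: block_metric_on; exact: manifold_metric_on. Qed.

Lemma product_riemann_split (j : chart_index P) x : img (atlas P j) x ->
  split_tensor (riemann (metric P j) x).
Proof.
case: j => j1 j2 xj.
have c1 := manifold_chart M1M j1; have c2 := manifold_chart M2M j2.
apply: (riemann_block_split (open_img c1) (open_img c2) _ _ xj); exact: manifold_metric_on.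
Qed.

Lemma product_orthonormal_frame (j : chart_index P) x : img (atlas P j) x ->
  exists (E1 : 'M[R]_n1) (E2 : 'M[R]_n2),
    block_mx E1 0 0 E2 *m metric P j x *m (block_mx E1 0 0 E2)^T = 1%:M.
Proof.
case: j => j1 j2 [/= x1 x2].
have [E1 e1] := exists_orthonormal_frame (Defs.metric_sym M1M x1)
   (fun v => metric_posdef M1M x1).
have [E2 e2] := exists_orthonormal_frame (Defs.metric_sym M2M x2)
   (fun v => metric_posdef M2M x2).
exists E1, E2; rewrite tr_block_mx !trmx0 !mulmx_block.
by rewrite !(mulmx0, mul0mx, addr0, add0r) e1 e2 -scalar_mx_block.
Qed.

(** The definition of an isometry leaves the two dimensions independent of each other, but it
    provides an inverse in both directions. *)
Lemma isometric_product_dim (Mt : riemannian_data R n) (q : Mt) :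
  riemannian_manifold Mt -> isometric Mt P -> n = (n1 + n2)%N.
Proof.
move=> MtM [F [Fs _ [G [FG GF Gs]]]].
have [t qt] := manifold_cover MtM q; have [j Fqj] := product_cover (F q).
have ct := inverse_chart_of_chart (manifold_chart MtM t); have cj := product_chart j.
have [ty bq] := inverse_chart_fwdK ct qt.
have yd : local_dom F t j (fwd (atlas Mt t) q) by split; rewrite /= ?bq.
have [zd _] := local_rep_inverse ct cj FG yd.
apply/eqP; rewrite eqn_leq (leq_dim_of_left_inverse Fs Gs FG ct cj yd).
exact: (leq_dim_of_left_inverse Gs Fs GF cj ct zd).
Qed.

End ProductCover.

(** In an orthonormal frame adapted to the product, the curvature tensor of M at f q has the
    components of the curvature tensor of the product, because f and the isometry F are local
    isometries. Those components are split, hence zero. *)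
Lemma nonneg_isometric_product_flat (R : realType) (n1 n2 : nat)
    (M Mt : riemannian_data R (n1 + n2)) (f : Mt -> M)
    (M1 : riemannian_data R n1) (M2 : riemannian_data R n2) (q : Mt)
    (c : chart_index M) :
  (0 < n1)%N -> (0 < n2)%N ->
  riemannian_manifold M -> riemannian_manifold Mt ->
  riemannian_manifold M1 -> riemannian_manifold M2 ->
  smooth_map f -> preserves_metric f ->
  isometric Mt (riemannian_product M1 M2) ->
  manifold_k_nonneg_second_kind (n1 + n2) M ->
  dom (atlas M c) (f q) ->
  forall i j k l, riemann (metric M c) (fwd (atlas M c) (f q)) i j k l = 0.
Proof.
move=> n10 n20 MM MtM M1M M2M fs fm [F [Fs Fm _]] Mk fqc.
set P := riemannian_product M1 M2 in F Fs Fm.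
have [t qt] := manifold_cover MtM q; have [p Fqp] := product_cover M1M M2M (F q).
have ct := inverse_chart_of_chart (manifold_chart MtM t).
have cp := product_chart M1M M2M p.
have cc := inverse_chart_of_chart (manifold_chart MM c).
have gt := manifold_metric_on t MtM; have gc := manifold_metric_on c MM.
have gp := product_metric_on M1M M2M p.
have [ty bq] := inverse_chart_fwdK ct qt.
set y := fwd (atlas Mt t) q in ty bq.
have ydf : local_dom f t c y by split; rewrite /= ?bq.
have ydF : local_dom F t p y by split; rewrite /= ?bq.
have ex : local_rep f t c y = fwd (atlas M c) (f q) by rewrite /local_rep bq.
rewrite -ex; set x := local_rep f t c y; set z := local_rep F t p y.
have xc : img (atlas M c) x by exact: local_rep_img ydf.
have zp : img (atlas P p) z by exact: local_rep_img ydF.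
have Rf := riemann_local_isometry fs fm ct cc gt gc ydf.
have RF := riemann_local_isometry Fs Fm ct cp gt gp ydF.
have hf := fm _ _ _ ydf; have hF := Fm _ _ _ ydF.
rewrite -/x -/z /= in Rf RF hf hF.
set Jf := jacobian _ y in Rf hf; set JF := jacobian _ y in RF hF.
have uJF : JF \in unitmx.
  by have := metric_on_unit gt ty; rewrite hF -mulmxA unitmx_mul => /andP[].
have [E1 [E2 EP1]] := product_orthonormal_frame M1M M2M zp.
set EP := block_mx E1 0 0 E2 in EP1.
(* Et is the adapted frame of the product carried over to Mt, and E its image in M. *)
have [Et EtJF] : exists Et, Et *m JF = EP by exists (EP *m invmx JF); rewrite mulmxKV.
pose E := Et *m Jf.
have E1M : E *m metric M c x *m E^T = 1%:M.
  have -> : E *m metric M c x *m E^T = Et *m metric Mt t y *m Et^T.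
    by rewrite hf /E trmx_mul !mulmxA.
  have -> : Et *m metric Mt t y *m Et^T = EP *m metric P p z *m EP^T.
    by rewrite hF -EtJF trmx_mul !mulmxA.
  exact: EP1.
have uE : E \in unitmx by case/mulmx1_unit: (etrans (mulmxA E (metric M c x) E^T) E1M).
set T := tensor_in_frame (riemann (metric M c) x) E.
have TE : T = tensor_in_frame (riemann (metric P p) z) EP.
  by rewrite /T /E -tensor_in_frame_comp -Rf RF tensor_in_frame_comp EtJF.
have T0 : forall i j k l, T i j k l = 0.
  apply: split_k_nonneg_eq0 => //.
  - apply: tensor_in_frame_curv.
    exact: (riemann_algebraic_curvature (inverse_chart_open_img cc) gc).
  - rewrite TE; apply: tensor_in_block_frame_split.
    exact: (product_riemann_split M1M M2M zp).
  - exact: Mk.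
(* Back from the frame E to the coordinate frame. *)
have -> : riemann (metric M c) x = tensor_in_frame T (invmx E).
  by rewrite tensor_in_frame_comp mulVmx // tensor_in_frame1.
have -> : T = (fun _ _ _ _ => 0).
  by do 4![apply/funext => ?]; exact: T0.
by move=> i j k l; exact: tensor_in_frame0.
Qed.

Theorem theorem1p8 (R : realType) (n : nat) (M : riemannian_data R n) :
  (2 <= n)%N ->
  riemannian_manifold M ->
  complete_manifold M ->
  nonflat M ->
  manifold_k_nonneg_second_kind n M ->
  locally_irreducible M.
Proof.
move=> _ MM _ [c [x [i [j [k [l [xc Rx]]]]]]] Mk Mt f [MtM _ [_ fsurj _] fs fm].
move=> [n1 [n2 [M1 [M2 [n10 n20 M1M M2M iso]]]]].
have cc := inverse_chart_of_chart (manifold_chart MM c).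
have [dx ex] := inverse_chart_bwdK cc xc.
have [q fq] := fsurj (bwd (atlas M c) x).
have nE := isometric_product_dim M1M M2M q MtM iso; subst n.
have fqc : dom (atlas M c) (f q) by rewrite fq.
have := nonneg_isometric_product_flat n10 n20 MM MtM M1M M2M fs fm iso Mk fqc i j k l.
by rewrite fq ex => /eqP; rewrite (negbTE Rx).
Qed.
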